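(* Let $n\ge 1$ and let $\Omega:\mathbb{R}^n\setminus\{0\}\to\mathbb{C}$ satisfy: $\Omega|_{S^{n-1}}\in L^\infty(S^{n-1})$; $\Omega(rx')=\Omega(x')$ for all $r>0$ (homogeneous of degree $0$); $\int_{S^{n-1}}\Omega(x')\,d\sigma(x')=0$; and, for some $0<\alpha\le 1$, $\int_0^1 \frac{\omega_\infty(\delta)}{\delta^{1+\alpha}}\,d\delta<\infty$, where $\omega_\infty(\delta)=\sup\{|\Omega(x')-\Omega(y')|: |x'-y'|\le\delta,\ |x'|=|y'|=1\}$. For $0<\beta<n$ let $$T_\beta f(x)=\mathrm{p.v.}\int_{\mathbb{R}^n}\frac{\Omega(y)}{|y|^{n-\beta}}f(x-y)\,dy.$$ If $\frac{n}{n+\alpha}<p<1<q<\infty$ satisfy $\frac1p+\frac1q=2$, then there exists a constant $C>0$ such that $$\|T_\beta f\|_{Lip_{n(\frac1p-1)}}\le C\left(\|f\|_{Lip_{n(\frac1p-1)}}+\frac{\beta^{\frac{(q-1)n}{q}}}{\sqrt[q]{n(q-1)-\beta q}}\,\|f\|_{BMO}\right)$$ for all $f\in Lip_{n(\frac1p-1)}\cap BMO$ and all $0<\beta<\frac{(q-1)n}{q}$.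
   Context: For $0<\gamma<1$, $Lip_\gamma(\mathbb{R}^n)$ is the space of functions $f$ with $\|f\|_{Lip_\gamma}=\sup_{x\ne y}\frac{|f(x)-f(y)|}{|x-y|^\gamma}<\infty$ (note $0<n(\frac1p-1)<\alpha\le1$ here). $BMO$ is the space of locally integrable $f$ with $\|f\|_{BMO}=\sup_Q\frac{1}{|Q|}\int_Q|f-f_Q|<\infty$ (supremum over cubes, $f_Q$ the average of $f$ on $Q$), modulo constants.
   Formalization: The principal value T_β f can diverge for some f in Lip∩BMO (n=1, Ω=sgn, f smooth, equal to sgn at infinity); the formal theorem covers those f for which the limit of integrals over ε<|y|<1/ε exists at every x. *)

(* Defs.v *)
(* Points of R^n are n.-tuples of reals
   (n.-tuple R carries the product = Borel sigma-algebra in mathcomp-analysis);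
   complex numbers are R[i] from mathcomp-real-closed (R : realType is an rcfType). *)
From HB Require Import structures.
From mathcomp Require Import all_boot all_order all_algebra.
From mathcomp Require Import all_classical all_reals all_analysis.
From mathcomp Require complex.
From mathcomp Require Import ess_sup_inf.
Set Implicit Arguments. Unset Strict Implicit. Unset Printing Implicit Defensive.
Import Order.TTheory GRing.Theory Num.Theory.
Import numFieldNormedType.Exports.
Local Open Scope classical_set_scope.
Local Open Scope ring_scope.

Notation Cx R := (complex.complex R).

Section Defs.
Context {R : realType} {n : nat}.

Definition pt := n.-tuple R.

Definition vsub (x y : pt) : pt := [tuple tnth x i - tnth y i | i < n].
Definition vscale (r : R) (x : pt) : pt := [tuple r * tnth x i | i < n].
Definition vzero : pt := [tuple (0 : R) | i < n].

Definition enorm (x : pt) : R := Num.sqrt (\sum_(i < n) tnth x i ^+ 2).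

Definition sphere : set pt := [set x | enorm x = 1].

Definition cabs (z : Cx R) : R :=
  Num.sqrt (complex.Re z ^+ 2 + complex.Im z ^+ 2).
Definition csub (z w : Cx R) : Cx R :=
  complex.Complex (complex.Re z - complex.Re w) (complex.Im z - complex.Im w).
Definition cmul (z w : Cx R) : Cx R :=
  complex.Complex (complex.Re z * complex.Re w - complex.Im z * complex.Im w)
                  (complex.Re z * complex.Im w + complex.Im z * complex.Re w).
Definition crscale (r : R) (z : Cx R) : Cx R :=
  complex.Complex (r * complex.Re z) (r * complex.Im z).

Definition box (a b : pt) : set pt :=
  [set x | forall i, tnth a i < tnth x i <= tnth b i].

(* mu is n-dimensional Lebesgue measure: the (unique) Borel measure on R^n
   giving every box its volume *)
Definition is_lebesgue (mu : {measure set pt -> \bar R}) : Prop :=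
  forall a b : pt, (forall i, tnth a i <= tnth b i) ->
    mu (box a b) = (\prod_(i < n) (tnth b i - tnth a i))%:E.

(* sigma is the surface measure on S^{n-1} (extended by 0 outside the sphere),
   defined as in Folland (Thm 2.49): sigma(E) = n * mu({ r x : 0 < r <= 1, x in E }) *)
Definition is_surface_measure (mu sig : {measure set pt -> \bar R}) : Prop :=
  forall A : set pt, measurable A ->
    (sig A = (n%:R)%:E * mu [set y | exists (r : R) (x : pt), (0 < r <= 1)%R /\ A x /\ sphere x
                                             /\ y = vscale r x])%E.

Definition cintegral (mu : {measure set pt -> \bar R}) (D : set pt)
    (g : pt -> Cx R) : Cx R :=
  complex.Complex (fine (\int[mu]_(x in D) (complex.Re (g x))%:E))
                  (fine (\int[mu]_(x in D) (complex.Im (g x))%:E)).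

Definition cmeasurable (D : set pt) (g : pt -> Cx R) : Prop :=
  measurable_fun D (fun x => complex.Re (g x)) /\
  measurable_fun D (fun x => complex.Im (g x)).

Definition lip_norm (gamma : R) (f : pt -> Cx R) : \bar R :=
  ereal_sup [set v | exists x y : pt, x != y /\
     v = (cabs (csub (f x) (f y)) / enorm (vsub x y) `^ gamma)%:E].

Definition cube (c : pt) (l : R) : set pt :=
  [set x | forall i, tnth c i <= tnth x i < tnth c i + l].

Definition is_cube (Q : set pt) : Prop := exists c l, 0 < l /\ Q = cube c l.

Definition cavg (mu : {measure set pt -> \bar R}) (Q : set pt) (f : pt -> Cx R)
  : Cx R := crscale (fine (mu Q))^-1 (cintegral mu Q f).

Definition bmo_norm (mu : {measure set pt -> \bar R}) (f : pt -> Cx R) : \bar R :=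
  ereal_sup [set v | exists Q, is_cube Q /\
     v = (((fine (mu Q))^-1)%:E *
         \int[mu]_(x in Q) (cabs (csub (f x) (cavg mu Q f)))%:E)%E].

Definition loc_integrable (mu : {measure set pt -> \bar R}) (f : pt -> Cx R) : Prop :=
  forall Q, is_cube Q ->
    mu.-integrable Q (fun x => (complex.Re (f x))%:E) /\
    mu.-integrable Q (fun x => (complex.Im (f x))%:E).

Definition omega_inf (Om : pt -> Cx R) (d : R) : \bar R :=
  ereal_sup [set v | exists x y, sphere x /\ sphere y /\ enorm (vsub x y) <= d /\
     v = (cabs (csub (Om x) (Om y)))%:E].

Definition Ttrunc (mu : {measure set pt -> \bar R}) (Om : pt -> Cx R) (beta : R)
    (f : pt -> Cx R) (eps : R) (x : pt) : Cx R :=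
  cintegral mu [set y | eps < enorm y < eps^-1]
    (fun y => crscale (enorm y `^ (n%:R - beta))^-1 (cmul (Om y) (f (vsub x y)))).

Definition is_Tbeta (mu : {measure set pt -> \bar R}) (Om : pt -> Cx R) (beta : R)
    (f Tf : pt -> Cx R) : Prop :=
  forall x : pt,
    (fun eps => complex.Re (Ttrunc mu Om beta f eps x)) @ 0^'+ --> complex.Re (Tf x) /\
    (fun eps => complex.Im (Ttrunc mu Om beta f eps x)) @ 0^'+ --> complex.Im (Tf x).

End Defs.

(* Main.v *)
Require Import Defs.
From HB Require Import structures.
From mathcomp Require Import all_boot all_order all_algebra.
From mathcomp Require Import all_classical all_reals all_analysis.
From mathcomp Require complex.
From mathcomp Require Import ess_sup_inf.
From mathcomp Require Import measurable_realfun lra ring.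
Import Order.TTheory GRing.Theory Num.Theory.
Import numFieldNormedType.Exports.
Local Open Scope classical_set_scope.
Local Open Scope ring_scope.
Set Implicit Arguments. Unset Strict Implicit. Unset Printing Implicit Defensive.

(* Write g = n(1/p - 1) = n(q - 1)/q, so that 0 < beta < g < alpha <= 1, and let L and
   B be the Lipschitz and BMO norms of f.  On a cube of side s the mean oscillation of f
   is at most a multiple of min(L s^g, B) <= M s^(g - beta), where
   M = L^(1 - beta/g) B^(beta/g); since beta^(-beta) <= e, M is bounded by a constant
   times L + beta^g B.  It therefore suffices to map the Campanato condition with
   exponent g - beta into Lip_g with a constant independent of beta.
   Put h = |x - z|.  Near the singularity, each dyadic shell of radius r is integrated
   against f minus its own average, because the kernel has mean zero on shells; this
   contributes M r^g, summable up to r = 4h.  Away from it, the Dini condition gives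
   |Omega(u) - Omega(v)| <= C |u - v|^alpha on the sphere, hence
   |K(y) - K(y + z - x)| <= C |y|^(beta - n) (h/|y|)^alpha; the averages of f on
   concentric dyadic cubes drift only by a factor 2^(k (alpha - g)/2), so the sum over
   shells converges since g < alpha.  Truncating both integrals at |y| = 1/eps leaves a
   thin shell whose contribution is O(eps^(1 - (alpha + g)/2)). *)

Section PowR.
Context {R : realType}.
Implicit Types (a b c r s t : R).

Lemma powRD_gt0 a r s : 0 < a -> a `^ (r + s) = a `^ r * a `^ s.
Proof. by move=> a0; apply: powRD; apply/implyP => _; rewrite gt_eqF. Qed.

Lemma powR_le a b r : 0 <= r -> 0 <= a -> a <= b -> a `^ r <= b `^ r.
Proof.
move=> r0 a0 ab; apply: ge0_ler_powR => //; rewrite nnegrE//.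
exact: le_trans ab.
Qed.

Lemma powRN_le a b r : 0 <= r -> 0 < a -> a <= b -> b `^ (- r) <= a `^ (- r).
Proof.
move=> r0 a0 ab; rewrite !powRN lef_pV2 ?posrE ?powR_gt0 ?(lt_le_trans a0)//.
by apply: powR_le => //; exact: ltW.
Qed.

Lemma powR_gt1 a r : 1 < a -> 0 < r -> 1 < a `^ r.
Proof.
move=> a1 r0; rewrite -[ltLHS](_ : 1 `^ r = 1); last by rewrite powR1.
by apply: gt0_ltr_powR; rewrite ?nnegrE// ltW// (lt_trans ltr01).
Qed.

Lemma powR_scale c s r (m : nat) : 1 <= c -> 0 <= s -> r <= m%:R ->
  (c * s) `^ r <= c ^+ m * s `^ r.
Proof.
move=> c1 s0 rm; have c0 : 0 <= c by exact: le_trans c1.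
rewrite (powRM _ c0 s0) ler_wpM2r ?powR_ge0//.
by rewrite -(powR_mulrn _ c0) ler_powR.
Qed.

Lemma powRN_scale c s t r (m : nat) : 1 <= c -> 0 < s -> 0 < t -> t <= c * s ->
  0 <= r <= m%:R -> s `^ (- r) <= c ^+ m * t `^ (- r).
Proof.
move=> c1 s0 t0 tcs /andP[r0 rm]; have c0 : 0 < c by exact: lt_le_trans c1.
rewrite !powRN ler_pdivlMr ?powR_gt0// mulrC ler_pdivrMr ?powR_gt0//.
apply: le_trans (powR_scale c1 (ltW s0) rm).
by apply: powR_le => //; exact: ltW.
Qed.

Lemma ex_pow2 r : 1 <= r -> exists k, r <= 2 ^+ k <= 2 * r.
Proof.
move=> r1.
have H : exists k, r <= 2 ^+ k.
  exists (Num.truncn r).+1; apply: ltW; apply: lt_trans (truncnS_gt r) _.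
  by rewrite -natrX ltr_nat ltn_expl.
have [k rk kmin] := ex_minnP H; exists k; rewrite rk /=.
case: k rk kmin => [|k] rk kmin; first by rewrite expr0; lra.
rewrite exprS ler_pM2l//; apply: ltW; rewrite ltNge; apply/negP => /kmin.
by rewrite ltnn.
Qed.

End PowR.

(** * Euclidean vectors *)

Lemma measurable_sqrtr (R : realType) : measurable_fun setT (@Num.sqrt R).
Proof.
rewrite (_ : Num.sqrt = fun x : R => Num.sqrt (Num.max x 0)).
  rewrite (_ : (fun _ => _) = (fun t : R => t `^ 2^-1) \o (fun t : R => Num.max t 0)).
    apply: measurableT_comp => //; exact: measurable_maxr.
  by apply/funext => x /=; rewrite powR12_sqrt// le_max lexx orbT.
apply/funext => x; case: (leP x 0) => [x0|x0].
  by rewrite sqrtr0 ler0_sqrtr.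
by [].
Qed.

Section Euclidean.
Context {R : realType} {n : nat}.
Local Notation V := (n.-tuple R).
Implicit Types (x y z : V) (r : R).

Lemma tnth_vsub x y i : tnth (vsub x y) i = tnth x i - tnth y i.
Proof. by rewrite tnth_mktuple. Qed.

Lemma tnth_vscale r x i : tnth (vscale r x) i = r * tnth x i.
Proof. by rewrite tnth_mktuple. Qed.

Lemma tnth_vzero i : tnth (vzero : V) i = 0.
Proof. by rewrite tnth_mktuple. Qed.

Lemma vsubK x y : vsub x (vsub x y) = y.
Proof. by apply: eq_from_tnth => i; rewrite !tnth_vsub subKr. Qed.

Lemma vscaleA r (s : R) x : vscale r (vscale s x) = vscale (r * s) x.
Proof. by apply: eq_from_tnth => i; rewrite !tnth_vscale mulrA. Qed.

Lemma vscale1 x : vscale 1 x = x.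
Proof. by apply: eq_from_tnth => i; rewrite !tnth_vscale mul1r. Qed.

Lemma vsubx0 x : vsub x vzero = x.
Proof. by apply: eq_from_tnth => i; rewrite tnth_vsub tnth_vzero subr0. Qed.

Lemma enorm_ge0 x : 0 <= enorm x.
Proof. exact: sqrtr_ge0. Qed.

Lemma sqr_enorm x : enorm x ^+ 2 = \sum_(i < n) tnth x i ^+ 2.
Proof. by rewrite sqr_sqrtr// sumr_ge0// => i _; rewrite sqr_ge0. Qed.

Lemma cauchy_schwarz (a b : 'I_n -> R) :
  (\sum_i a i * b i) ^+ 2 <= (\sum_i a i ^+ 2) * (\sum_i b i ^+ 2).
Proof.
have : 0 <= \sum_i \sum_j (a i * b j - a j * b i) ^+ 2.
  by apply: sumr_ge0 => i _; apply: sumr_ge0 => j _; rewrite sqr_ge0.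
have -> : \sum_i \sum_j (a i * b j - a j * b i) ^+ 2 =
    \sum_i \sum_j (a i ^+ 2 * b j ^+ 2) + \sum_i \sum_j (a j ^+ 2 * b i ^+ 2)
    - 2 * \sum_i \sum_j ((a i * b i) * (a j * b j)).
  rewrite mulr_sumr -big_split /= -sumrB; apply: eq_bigr => i _.
  by rewrite mulr_sumr -big_split /= -sumrB; apply: eq_bigr => j _; ring.
rewrite [X in _ + X - _]exchange_big /= -!(big_distrlr _ _) /=.
set S := \sum_i a i * b i; set A := \sum_i a i ^+ 2; set B := \sum_i b i ^+ 2.
by rewrite !expr2 => H; lra.
Qed.

Lemma enorm_vsub_le x y : enorm (vsub x y) <= enorm x + enorm y.
Proof.
rewrite -(@ler_pXn2r _ 2) ?nnegrE ?addr_ge0 ?enorm_ge0//.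
rewrite sqrrD !sqr_enorm.
have -> : \sum_i tnth (vsub x y) i ^+ 2 = \sum_i tnth x i ^+ 2 +
   \sum_i tnth y i ^+ 2 - 2 * \sum_i tnth x i * tnth y i.
  by rewrite mulr_sumr -big_split /= -sumrB; apply: eq_bigr => i _;
    rewrite tnth_vsub; ring.
have H : - \sum_i tnth x i * tnth y i <= enorm x * enorm y.
  apply: le_trans (ler_norm _) _; rewrite normrN.
  rewrite -(@ler_pXn2r _ 2) ?nnegrE ?mulr_ge0 ?enorm_ge0//.
  by rewrite real_normK ?num_real// exprMn !sqr_enorm cauchy_schwarz.
by rewrite mulr2n; lra.
Qed.

Lemma enorm_triangle y x z :
  enorm (vsub x z) <= enorm (vsub x y) + enorm (vsub z y).
Proof.
have -> : vsub x z = vsub (vsub x y) (vsub z y).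
  by apply: eq_from_tnth => i; rewrite !tnth_vsub; ring.
exact: enorm_vsub_le.
Qed.

Lemma enormB x y : enorm (vsub x y) = enorm (vsub y x).
Proof.
by congr Num.sqrt; apply: eq_bigr => i _; rewrite !tnth_vsub -sqrrN opprB.
Qed.

Lemma enorm_vsub_ge x y : enorm x - enorm y <= enorm (vsub x y).
Proof.
have := enorm_triangle y x vzero.
by rewrite vsubx0 (enormB vzero) vsubx0; lra.
Qed.

Lemma enorm_vscale r x : enorm (vscale r x) = `|r| * enorm x.
Proof.
rewrite -sqrtr_sqr -sqrtrM ?sqr_ge0// mulr_sumr; congr Num.sqrt.
by apply: eq_bigr => i _; rewrite tnth_vscale exprMn.
Qed.

Lemma le_tnth_enorm x i : `|tnth x i| <= enorm x.
Proof.
rewrite -sqrtr_sqr ler_sqrt; last by rewrite sumr_ge0// => j _; rewrite sqr_ge0.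
by rewrite (bigD1 i)//= lerDl sumr_ge0// => j _; rewrite sqr_ge0.
Qed.

Lemma enorm_vzero : enorm (vzero : V) = 0.
Proof.
rewrite /enorm big1 ?sqrtr0// => i _.
by rewrite tnth_vzero expr0n.
Qed.

Lemma enorm_eq0 x : (enorm x == 0) = (x == vzero).
Proof.
apply/eqP/eqP => [x0|->]; last exact: enorm_vzero.
apply: eq_from_tnth => i; rewrite tnth_vzero; apply/eqP.
by rewrite -normr_le0 -x0 le_tnth_enorm.
Qed.

Lemma enorm_gt0 x : (0 < enorm x) = (x != vzero).
Proof. by rewrite lt_def enorm_eq0 enorm_ge0 andbT. Qed.

Lemma enorm_vsub_gt0 x y : (0 < enorm (vsub x y)) = (x != y).
Proof.
rewrite enorm_gt0; congr negb; apply/eqP/eqP => [xy|->].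
  by apply: eq_from_tnth => i; have := congr1 (fun t => tnth t i) xy;
    rewrite tnth_vsub tnth_vzero => /subr0_eq.
by apply: eq_from_tnth => i; rewrite tnth_vsub tnth_vzero subrr.
Qed.

Lemma enorm_le_max x r : (forall i, `|tnth x i| <= r) -> enorm x <= n%:R * r.
Proof.
move=> xr; case: (posnP n) => [n0|n0].
  have -> : enorm x = 0.
    by rewrite /enorm big1 ?sqrtr0// => i _; move: (ltn_ord i); rewrite {2}n0.
  by rewrite n0 mul0r.
have r0 : 0 <= r by rewrite (le_trans _ (xr (Ordinal n0))).
rewrite -(@ler_pXn2r _ 2) ?nnegrE ?mulr_ge0 ?enorm_ge0// sqr_enorm.
apply: (@le_trans _ _ (\sum_(i < n) r ^+ 2)).
  apply: ler_sum => i _; rewrite -real_normK ?num_real//.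
  by rewrite ler_pXn2r ?nnegrE.
rewrite sumr_const card_ord exprMn -[leLHS]mulr_natl ler_wpM2r ?sqr_ge0//.
by rewrite -natrX ler_nat -[leqLHS]expn1 leq_pexp2l.
Qed.

Lemma measurable_vsub x : measurable_fun setT (vsub x).
Proof.
apply/measurable_fun_tnthP => i.
rewrite (_ : _ \o _ = fun y => tnth x i - tnth y i); last first.
  by apply/funext => y /=; rewrite tnth_vsub.
by apply: measurable_funB => //; exact: measurable_tnth.
Qed.

Lemma measurable_vsubr x : measurable_fun setT (vsub^~ x).
Proof.
apply/measurable_fun_tnthP => i.
rewrite (_ : _ \o _ = fun y => tnth y i - tnth x i); last first.
  by apply/funext => y /=; rewrite tnth_vsub.
by apply: measurable_funB => //; exact: measurable_tnth.
Qed.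

Lemma measurable_vscale r : measurable_fun setT (@vscale R n r).
Proof.
apply/measurable_fun_tnthP => i.
rewrite (_ : _ \o _ = fun y => r * tnth y i); last first.
  by apply/funext => y /=; rewrite tnth_vscale.
by apply: measurable_funM => //; exact: measurable_tnth.
Qed.

Lemma measurable_enorm : measurable_fun setT (@enorm R n).
Proof.
have ms := @measurable_sqrtr R.
apply: measurableT_comp => //; apply: measurable_sum => i.
by apply: measurable_funX; exact: measurable_tnth.
Qed.

Lemma measurable_unit_vector :
  measurable_fun setT (fun x => vscale (enorm x)^-1 x).
Proof.
apply/measurable_fun_tnthP => i.
rewrite (_ : _ \o _ = fun y => (enorm y)^-1 * tnth y i); last first.
  by apply/funext => y /=; rewrite tnth_vscale.
apply: measurable_funM; last exact: measurable_tnth.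
rewrite (_ : (fun _ => _) = (@powR R ^~ (-1)) \o @enorm R n).
  by apply: measurableT_comp => //; exact: measurable_enorm.
by apply/funext => y /=; rewrite powR_inv1 ?enorm_ge0.
Qed.

Lemma measurable_ball_le r : measurable [set x : V | enorm x <= r].
Proof.
rewrite -[X in measurable X]setTI.
rewrite (_ : [set x | _] = enorm @^-1` `]-oo, r]); last first.
  by apply/seteqP; split => x /=; rewrite in_itv.
exact: measurable_enorm.
Qed.

Lemma measurable_shell r (s : R) : measurable [set x : V | r < enorm x <= s].
Proof.
rewrite -[X in measurable X]setTI.
rewrite (_ : [set x | _] = enorm @^-1` `]r, s]); last first.
  by apply/seteqP; split => x /=; rewrite in_itv.
exact: measurable_enorm.
Qed.

Lemma measurable_oshell r (s : R) : measurable [set x : V | r < enorm x < s].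
Proof.
rewrite -[X in measurable X]setTI.
rewrite (_ : [set x | _] = enorm @^-1` `]r, s[); last first.
  by apply/seteqP; split => x /=; rewrite in_itv.
exact: measurable_enorm.
Qed.

Lemma measurable_vne0 : measurable [set x : V | x != vzero].
Proof.
rewrite -[X in measurable X]setTI.
rewrite (_ : [set x | _] = enorm @^-1` `]0, +oo[); last first.
  by apply/seteqP; split => x /=; rewrite in_itv /= andbT enorm_gt0.
exact: measurable_enorm.
Qed.

End Euclidean.

(** * Lebesgue measure *)

Section Lebesgue.
Context {R : realType} {n : nat}.
Local Notation V := (n.-tuple R).
Implicit Types (a b c x y z : V) (r : R).

Lemma measurable_box a b : measurable (box a b).
Proof.
rewrite (_ : box a b = \bigcap_(i in [set: 'I_n])
    ((fun x : V => tnth x i) @^-1` `]tnth a i, tnth b i])).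
  apply: fin_bigcap_measurable; first exact: finite_finset.
  move=> i _; rewrite -[X in measurable X]setTI.
  exact: measurable_tnth.
apply/seteqP; split => x /=.
  by move=> xab i _ /=; rewrite in_itv /= xab.
by move=> xab i; have := xab i I; rewrite /= in_itv.
Qed.

Lemma boxI a b c (d : V) : box a b `&` box c d =
  box [tuple Num.max (tnth a i) (tnth c i) | i < n]
      [tuple Num.min (tnth b i) (tnth d i) | i < n].
Proof.
apply/seteqP; split => x /=.
  move=> [xab xcd] i; rewrite !tnth_mktuple gt_max le_min.
  by have /andP[-> ->] := xab i; have /andP[-> ->] := xcd i.
move=> H; split=> i; have := H i; rewrite !tnth_mktuple gt_max le_min;
  by move=> /andP[/andP[? ?] /andP[? ?]]; exact/andP.
Qed.

Let boxes : set (set V) := [set A | exists a b, A = box a b].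

Let centered_box (k : nat) : set V :=
  box [tuple - k%:R | i < n] [tuple k%:R | i < n].

Let centered_box_cover : \bigcup_k centered_box k = [set: V].
Proof.
apply/seteqP; split => // x _.
exists (Num.truncn (enorm x)).+1 => // i; rewrite !tnth_mktuple.
have H : `|tnth x i| < (Num.truncn (enorm x)).+1%:R.
  exact: le_lt_trans (le_tnth_enorm x i) (truncnS_gt _).
by move: H; rewrite ltr_norml => /andP[-> /ltW ->].
Qed.

Lemma measurable_tuple_boxE : (measurable : set (set V)) = <<s boxes >>.
Proof.
apply/seteqP; split; last first.
  apply: smallest_sub; first exact: sigma_algebra_measurable.
  by move=> _ [a [b ->]]; exact: measurable_box.
have mt i : measurable_fun setT
    (fun x : g_sigma_algebraType boxes => tnth (x : V) i).
  apply: (@measurability _ _ _ _ _ _ (ocitv (R := R))) => //.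
  move=> _ [_ [[u v] _ <-] <-]; rewrite setTI /=.
  rewrite (_ : _ @^-1` _ = \bigcup_k
     (box [tuple if j == i then u else - k%:R | j < n]
          [tuple if j == i then v else k%:R | j < n])).
    apply: bigcup_measurable => k _; apply: sub_sigma_algebra.
    by eexists; eexists.
  apply/seteqP; split => x /=.
    rewrite in_itv /= => uxv; exists (Num.truncn (enorm x)).+1 => // j.
    rewrite !tnth_mktuple; case: eqVneq => [->//|ji].
    have H : `|tnth x j| < (Num.truncn (enorm x)).+1%:R.
      exact: le_lt_trans (le_tnth_enorm x j) (truncnS_gt _).
    by move: H; rewrite ltr_norml => /andP[-> /ltW ->].
  by move=> [k _ /(_ i)]; rewrite !tnth_mktuple eqxx in_itv.
apply: smallest_sub; first exact: smallest_sigma_algebra.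
move=> A; rewrite -bigcup_seq /= => -[i _ [B mB <-]].
exact: (mt i).
Qed.

Lemma lebesgue_unique (m1 m2 : {measure set V -> \bar R}) (A : set V) :
  is_lebesgue m1 -> is_lebesgue m2 -> measurable A -> m1 A = m2 A.
Proof.
move=> l1 l2; apply: (measure_unique boxes centered_box).
- exact: measurable_tuple_boxE.
- by move=> _ _ [a [b ->]] [c [d ->]]; rewrite boxI; eexists; eexists.
- by move=> k; eexists; eexists.
- exact: centered_box_cover.
- move=> _ [a [b ->]].
  have [ab|/forallPn[i /negP]] := boolP [forall i, tnth a i <= tnth b i].
    by rewrite l1 ?l2//; exact/forallP.
  move/negP; rewrite -ltNge => ba.
  suff -> : box a b = set0 by rewrite !measure0.
  apply/seteqP; split => // x /= /(_ i) /andP[ax xb].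
  by have := lt_le_trans ax xb; rewrite ltNge (ltW ba).
- move=> k; rewrite l1 ?ltry// => i; rewrite !tnth_mktuple.
  by rewrite (@le_trans _ _ 0)// oppr_le0.
Qed.

Variable mu : {measure set V -> \bar R}.
Hypothesis mu_leb : is_lebesgue mu.

Definition cobox a b : set V :=
  [set x | forall i, tnth a i <= tnth x i < tnth b i].

Lemma measurable_cobox a b : measurable (cobox a b).
Proof.
rewrite (_ : cobox a b = \bigcap_(i in [set: 'I_n])
    ((fun x : V => tnth x i) @^-1` `[tnth a i, tnth b i[)).
  apply: fin_bigcap_measurable; first exact: finite_finset.
  move=> i _; rewrite -[X in measurable X]setTI.
  exact: measurable_tnth.
apply/seteqP; split => x /=.
  by move=> xab i _ /=; rewrite in_itv /= xab.
by move=> xab i; have := xab i I; rewrite /= in_itv.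
Qed.

Lemma lebesgue_cobox a b : (forall i, tnth a i <= tnth b i) ->
  mu (cobox a b) = (\prod_(i < n) (tnth b i - tnth a i))%:E.
Proof.
move=> ab; set P := \prod_(i < n) _.
have P0 : 0 <= P by apply: prodr_ge0 => i _; rewrite subr_ge0.
have lo d : 0 < d < 1 -> (((1 - d) ^+ n * P)%:E <= mu (cobox a b))%E.
  move=> /andP[d0 d1].
  have E : mu (box a [tuple tnth a i + (1 - d) * (tnth b i - tnth a i) | i < n])
      = (\prod_(i < n) (tnth [tuple tnth a i + (1 - d) * (tnth b i - tnth a i)
           | i < n] i - tnth a i))%:E.
    apply: mu_leb => i; rewrite tnth_mktuple lerDl mulr_ge0 ?subr_ge0//.
    exact: ltW.
  rewrite (_ : (_ * P)%:E = mu (box a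
      [tuple tnth a i + (1 - d) * (tnth b i - tnth a i) | i < n])).
    apply: le_measure; rewrite ?inE; [exact: measurable_box|
      exact: measurable_cobox|].
    move=> x /= H i; have := H i; rewrite tnth_mktuple => /andP[/[dup] ax /ltW-> xb].
    have := lt_le_trans ax xb; rewrite ltrDl pmulr_rgt0 ?subr_gt0// => abi.
    by apply: le_lt_trans xb _; rewrite /= ; nra.
  rewrite E; congr (_%:E); rewrite /P -[X in _ ^+ X]card_ord -prodr_const -big_split /=.
  by apply: eq_bigr => i _; rewrite tnth_mktuple; ring.
have hi d : 0 < d < 1 -> (mu (cobox a b) <= ((1 + d) ^+ n * P)%:E)%E.
  move=> /andP[d0 d1].
  have E : mu (box [tuple tnth a i - d * (tnth b i - tnth a i) | i < n] b)
      = (\prod_(i < n) (tnth b i -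
           tnth [tuple tnth a i - d * (tnth b i - tnth a i) | i < n] i))%:E.
    by apply: mu_leb => i; rewrite tnth_mktuple; have := ab i; nra.
  rewrite (_ : (_ * P)%:E = mu (box
      [tuple tnth a i - d * (tnth b i - tnth a i) | i < n] b)).
    apply: le_measure; rewrite ?inE; [exact: measurable_cobox|
      exact: measurable_box|].
    move=> x /= H i; have := H i; rewrite tnth_mktuple => /andP[ax xb].
    by rewrite (ltW xb) andbT; have := le_lt_trans ax xb; nra.
  rewrite E; congr (_%:E); rewrite /P -[X in _ ^+ X]card_ord -prodr_const -big_split /=.
  by apply: eq_bigr => i _; rewrite tnth_mktuple; ring.
have fin : mu (cobox a b) \is a fin_num.
  rewrite ge0_fin_numE//; apply: le_lt_trans (hi 2^-1 _) (ltry _).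
  by apply/andP; split; lra.
rewrite -(fineK fin); congr (_%:E); apply/eqP; rewrite eq_le.
have cv (s : R) : (fun d : R => (1 + s * d) ^+ n * P) @ 0^'+ --> P.
  apply: cvg_at_right_filter.
  suff : (fun d : R => (1 + s * d) ^+ n * P) @ 0 --> (1 + s * 0) ^+ n * P.
    by rewrite mulr0 addr0 expr1n mul1r.
  apply: cvgM; last exact: cvg_cst.
  apply: (@cvg_comp _ _ _ (fun d : R => 1 + s * d) (fun t : R => t ^+ n) _
    (nbhs (1 + s * 0))); last exact: exprn_continuous.
  apply: cvgD; first exact: cvg_cst.
  by apply: cvgM; [exact: cvg_cst|exact: cvg_id].
have near01 : \forall d \near (0 : R)^'+, 0 < d < 1.
  near=> d; apply/andP; split; near: d; first exact: nbhs_right_gt.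
  exact: nbhs_right_lt.
apply/andP; split.
  apply: (cvgr_to_ge (cv 1)); near=> d; rewrite -lee_fin fineK// mul1r.
  by apply: hi; near: d.
apply: (cvgr_to_le (cv (-1))); near=> d; rewrite -lee_fin fineK// mulN1r.
by apply: lo; near: d.
Unshelve. all: by end_near. Qed.

Lemma lebesgue_cube c r : 0 <= r -> mu (cube c r) = (r ^+ n)%:E.
Proof.
move=> r0; rewrite (_ : cube c r = cobox c [tuple tnth c i + r | i < n]).
  rewrite lebesgue_cobox; last by move=> i; rewrite tnth_mktuple lerDl.
  rewrite -[X in _ ^+ X]card_ord -prodr_const; congr (_%:E); apply: eq_bigr => i _.
  by rewrite tnth_mktuple addrAC subrr add0r.
by apply/seteqP; split => x /= H i; have := H i; rewrite tnth_mktuple.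
Qed.

Lemma measurable_cube c r : measurable (cube c r).
Proof.
rewrite (_ : cube c r = cobox c [tuple tnth c i + r | i < n]).
  exact: measurable_cobox.
by apply/seteqP; split => x /= H i; have := H i; rewrite tnth_mktuple.
Qed.

Lemma lebesgue_reflect x (A : set V) : measurable A ->
  mu (vsub x @^-1` A) = mu A.
Proof.
have mx := measurable_vsub x.
apply: (@lebesgue_unique (pushforward mu (vsub x)) mu) => // a b ab.
rewrite /= /pushforward.
rewrite (_ : _ @^-1` _ = cobox (vsub x b) (vsub x a)).
  rewrite lebesgue_cobox => [|i]; last by rewrite !tnth_vsub lerB.
  by congr (_%:E); apply: eq_bigr => i _; rewrite !tnth_vsub; ring.
apply/seteqP; split => y /= H i; have := H i; rewrite !tnth_vsub; lra.
Qed.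

End Lebesgue.

Section Integration.
Context {R : realType} {n : nat}.
Local Notation V := (n.-tuple R).
Implicit Types (a b r : R) (x y z e : V) (g : V -> R) (D : set V).
Variable mu : {measure set V -> \bar R}.
Hypothesis mu_leb : is_lebesgue mu.

Lemma lebesgue_scale r (A : set V) : 0 < r -> measurable A ->
  mu A = ((r ^+ n)%:E * mu (vscale r @^-1` A))%E.
Proof.
move=> r0 mA; have mr := measurable_vscale (n := n) r.
have rn0 : 0 <= r ^+ n by rewrite exprn_ge0 // ltW.
rewrite (@lebesgue_unique R n mu (mscale (NngNum rn0) (pushforward mu (vscale r))))//.
move=> a b ab; rewrite /= /mscale /= /pushforward.
rewrite (_ : _ @^-1` _ = box (vscale r^-1 a) (vscale r^-1 b)).
  rewrite mu_leb => [|i]; last by rewrite !tnth_vscale ler_wpM2l ?ab// invr_ge0 ltW.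
  rewrite -EFinM -[X in _ ^+ X]card_ord -prodr_const -big_split /=.
  congr (_%:E); apply: eq_bigr => i _.
  by rewrite !tnth_vscale -mulrBr mulrA divff ?mul1r// gt_eqF.
apply/seteqP; split => y /= H i; have := H i; rewrite !tnth_vscale.
  by rewrite ltr_pdivrMl// ler_pdivlMl.
by rewrite ltr_pdivrMl// ler_pdivlMl.
Qed.

Lemma ball_le_lty r : (mu [set x | (enorm x <= r)%R] < +oo)%E.
Proof.
apply: (@le_lt_trans _ _ (mu (cube [tuple - `|r| | i < n] (`|r| + `|r| + 1)))).
  apply: le_measure; rewrite ?inE; [exact: measurable_ball_le|
    exact: measurable_cube|].
  move=> x /= xr i; rewrite tnth_mktuple.
  have := le_trans (le_tnth_enorm x i) (le_trans xr (ler_norm r)).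
  by rewrite ler_norml => /andP[-> ?]; lra.
by rewrite (lebesgue_cube mu_leb) ?ltry// !addr_ge0.
Qed.

Definition ebounded (D : set V) := exists r, D `<=` [set x | enorm x <= r].

Lemma ebounded_lty D : measurable D -> ebounded D -> (mu D < +oo)%E.
Proof.
move=> mD [r Dr]; apply: le_lt_trans (ball_le_lty r).
by apply: le_measure; rewrite ?inE//; exact: measurable_ball_le.
Qed.

Lemma bounded_integrable D g (M : R) : measurable D -> ebounded D ->
  measurable_fun setT g -> (forall x, D x -> `|g x| <= M) ->
  mu.-integrable D (EFin \o g).
Proof.
move=> mD bD mg gM; apply: measurable_bounded_integrable => //.
- exact: ebounded_lty.
- exact: measurable_funTS.
- exists M; split; first exact: num_real.
  by move=> t Mt x Dx /=; apply: le_trans (gM _ Dx) (ltW Mt).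
Qed.

Lemma integrable_addR D g (g' : V -> R) : measurable D ->
  mu.-integrable D (EFin \o g) -> mu.-integrable D (EFin \o g') ->
  mu.-integrable D (EFin \o (fun y => g y + g' y)).
Proof. by move=> mD i1 i2; have := integrableD mD i1 i2; apply: eq_integrable. Qed.

Lemma integral_reflect x D g : measurable D -> measurable_fun setT g ->
  (forall y, 0 <= g y) ->
  (\int[mu]_(y in vsub x @^-1` D) (g (vsub x y))%:E = \int[mu]_(y in D) (g y)%:E)%E.
Proof.
move=> mD mg g0; have mx := measurable_vsub x.
rewrite -(@ge0_integral_pushforward _ _ _ _ _ _ mx mu D (EFin \o g)) //=.
- by apply: eq_measure_integral => A mA _; exact: (lebesgue_reflect mu_leb).
- by apply/measurable_EFinP; exact: measurable_funTS.
- by move=> y _; rewrite /= lee_fin.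
Qed.

Lemma Rintegral_le_bound D g (M : R) : measurable D -> ebounded D ->
  measurable_fun setT g -> (forall x, D x -> `|g x| <= M) ->
  `|\int[mu]_(x in D) g x| <= M * fine (mu D).
Proof.
move=> mD bD mg gM.
have ig := bounded_integrable mD bD mg gM.
apply: le_trans (le_normr_Rintegral mD ig) _.
rewrite -Rintegral_cst//; apply: le_Rintegral => //.
- apply: (@bounded_integrable _ _ M) => //; first exact: measurableT_comp.
  by move=> x Dx; rewrite normr_id gM.
- by apply: (@bounded_integrable _ _ `|M|).
Qed.

Lemma Rintegral_dominated (E E' : set V) (F G : V -> R) :
  measurable E -> measurable E' -> E `<=` E' ->
  mu.-integrable E (EFin \o F) -> mu.-integrable E' (EFin \o G) ->
  (forall y, E' y -> 0 <= G y) -> (forall y, E y -> `|F y| <= G y) ->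
  `|\int[mu]_(y in E) F y| <= \int[mu]_(y in E') G y.
Proof.
move=> mE mE' EE' iF iG G0 FG.
have iGE : mu.-integrable E (EFin \o G) by exact: integrableS iG.
apply: le_trans (le_normr_Rintegral mE iF) _.
apply: (@le_trans _ _ (\int[mu]_(y in E) G y)).
  by apply: le_Rintegral => //; have := integrable_abse iF; apply: eq_integrable.
apply: fine_le.
- exact: integrable_fin_num iGE.
- exact: integrable_fin_num iG.
by apply: ge0_subset_integral => //; exact: (measurable_int mu).
Qed.

Lemma Rintegral_indic (U P : set V) g : P `<=` U ->
  \int[mu]_(y in P) g y = \int[mu]_(y in U) (\1_P y * g y).
Proof.
move=> PU; rewrite -{1}(setIidr PU) Rintegral_mkcondr.
apply: eq_Rintegral => y _; rewrite patchE indicE.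
by case: (y \in P); rewrite ?mul1r ?mul0r.
Qed.

Lemma Rintegral_translate e D g : measurable D -> measurable_fun setT g ->
  mu.-integrable ((vsub^~ e) @^-1` D) (EFin \o (g \o (vsub^~ e))) ->
  \int[mu]_(y in (vsub^~ e) @^-1` D) g (vsub y e) = \int[mu]_(y in D) g y.
Proof.
move=> mD mg ig; have mx := measurable_vsubr e; congr fine.
rewrite -(@integral_pushforward _ _ _ _ _ _ mx mu D (EFin \o g)) //=.
- apply: eq_measure_integral => A mA _ /=; rewrite /pushforward.
  have -> : (vsub^~ e) @^-1` A = vsub e @^-1` (vsub vzero @^-1` A).
    apply/seteqP; split => y /=;
      rewrite (_ : vsub vzero (vsub e y) = vsub y e)//;
      by apply: eq_from_tnth => i; rewrite !tnth_vsub tnth_vzero; ring.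
  rewrite !(lebesgue_reflect mu_leb)//.
  by rewrite -[X in measurable X]setTI; exact: measurable_vsub.
- exact/measurable_EFinP.
Qed.

Lemma bounded_shell a b : ebounded [set x : V | a < enorm x <= b].
Proof. by exists b => x /= /andP[]. Qed.

Lemma shell_setU a b c : a <= b -> b <= c ->
  [set x : V | a < enorm x <= c] =
  [set x | a < enorm x <= b] `|` [set x | b < enorm x <= c].
Proof.
move=> ab bc; apply/seteqP; split => x /=.
  by move=> /andP[ax xc]; case: (leP (enorm x) b) => ?; [left|right];
    apply/andP; split.
by move=> [|] /andP[? ?]; apply/andP; split; lra.
Qed.

Lemma shell_disj a b c : [disjoint [set x : V | a < enorm x <= b] &
  [set x | b < enorm x <= c]].
Proof.
apply/disj_setPS => x [] /= /andP[_ xb] /andP[bx _].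
by have := lt_le_trans bx xb; rewrite ltxx.
Qed.

Lemma Rintegral_shell_split a b c g : a <= b -> b <= c ->
  mu.-integrable [set x | a < enorm x <= c] (EFin \o g) ->
  \int[mu]_(x in [set x | a < enorm x <= c]) g x =
  \int[mu]_(x in [set x | a < enorm x <= b]) g x +
  \int[mu]_(x in [set x | b < enorm x <= c]) g x.
Proof.
move=> ab bc ig; rewrite (shell_setU ab bc) Rintegral_setU//.
- exact: measurable_shell.
- exact: measurable_shell.
- by rewrite -(shell_setU ab bc).
- exact: shell_disj.
Qed.

Definition unit_ball_volume := fine (mu [set x | enorm x <= 1]).

Lemma unit_ball_volume_ge0 : 0 <= unit_ball_volume.
Proof. exact: fine_ge0. Qed.

Lemma lebesgue_ball r : 0 < r ->
  mu [set x | enorm x <= r] = (r ^+ n * unit_ball_volume)%:E.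
Proof.
move=> r0; rewrite (lebesgue_scale r0); last exact: measurable_ball_le.
rewrite (_ : _ @^-1` _ = [set x | enorm x <= 1]).
  by rewrite EFinM fineK// ge0_fin_numE// ball_le_lty.
apply/seteqP; split => x /=; rewrite enorm_vscale gtr0_norm//.
  by rewrite -ler_pdivlMl// mulVf// gt_eqF.
by rewrite -ler_pdivlMl// mulVf// gt_eqF.
Qed.

Lemma lebesgue_shell a b : 0 < a -> a <= b ->
  fine (mu [set x | a < enorm x <= b]) = (b ^+ n - a ^+ n) * unit_ball_volume.
Proof.
move=> a0 ab.
have E : [set x : V | a < enorm x <= b] =
    [set x | enorm x <= b] `\` [set x | enorm x <= a].
  apply/seteqP; split => x /=.
    by move=> /andP[ax xb]; split => //; apply/negP; rewrite -ltNge.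
  by move=> [xb /negP]; rewrite -ltNge => ax; apply/andP.
rewrite E measureD; [|exact: measurable_ball_le|exact: measurable_ball_le|
  exact: ball_le_lty].
rewrite (_ : _ `&` _ = [set x | enorm x <= a]).
  have Eb := lebesgue_ball (lt_le_trans a0 ab); have Ea := lebesgue_ball a0.
  by rewrite [X in (X - _)%E]Eb [X in (_ - X)%E]Ea /= mulrBl.
by apply/seteqP; split => x /= => [[]//|xa]; split => //; exact: le_trans ab.
Qed.

Lemma lebesgue_sphere r : 0 < r -> mu [set x | enorm x = r] = 0.
Proof.
move=> r0; apply/eqP; rewrite eq_le measure_ge0 andbT.
have mS : measurable [set x : V | enorm x = r].
  rewrite -[X in measurable X]setTI.
  exact: (measurable_enorm _ (measurable_set1 r)).
have fS : mu [set x | enorm x = r] \is a fin_num.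
  rewrite ge0_fin_numE//; apply: ebounded_lty => //.
  by exists r => x /= ->.
rewrite -(fineK fS) lee_fin.
have cv : (fun d : R => (r ^+ n - (r * (1 - d)) ^+ n) * unit_ball_volume)
    @ 0^'+ --> (0 : R).
  apply: cvg_at_right_filter.
  suff : (fun d : R => (r ^+ n - (r * (1 - d)) ^+ n) * unit_ball_volume) @ 0
      --> (r ^+ n - (r * (1 - 0)) ^+ n) * unit_ball_volume.
    by rewrite subr0 mulr1 subrr mul0r.
  apply: cvgM; last exact: cvg_cst.
  apply: cvgB; first exact: cvg_cst.
  apply: (@cvg_comp _ _ _ (fun d : R => r * (1 - d)) (fun t : R => t ^+ n) _
    (nbhs (r * (1 - 0)))); last exact: exprn_continuous.
  apply: cvgM; first exact: cvg_cst.
  by apply: cvgB; [exact: cvg_cst|exact: cvg_id].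
apply: (cvgr_to_ge cv); near=> d.
have d0 : 0 < d by near: d; exact: nbhs_right_gt.
have d1 : d < 1 by near: d; exact: nbhs_right_lt.
have rd0 : 0 < r * (1 - d) by rewrite mulr_gt0// subr_gt0.
have rdr : r * (1 - d) < r by rewrite gtr_pMr// ltrBlDr ltrDl.
rewrite -lebesgue_shell//; last exact: ltW.
apply: fine_le => //.
  rewrite ge0_fin_numE//; apply: ebounded_lty; last exact: bounded_shell.
  exact: measurable_shell.
apply: le_measure; rewrite ?inE//; first exact: measurable_shell.
by move=> x /= ->; rewrite rdr lexx.
Unshelve. all: by end_near. Qed.

Lemma Rintegral_oshell a b g : a < b -> 0 < b ->
  mu.-integrable [set x | a < enorm x <= b] (EFin \o g) ->
  \int[mu]_(x in [set x | a < enorm x < b]) g x =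
  \int[mu]_(x in [set x | a < enorm x <= b]) g x.
Proof.
move=> ab b0 ig; congr fine.
rewrite [RHS](@negligible_integral _ _ _ mu _ [set x | enorm x = b]) //.
- congr integral; apply/seteqP; split => x /=.
    by move=> /andP[ax xb]; rewrite ax (ltW xb); split => // E; move: xb; rewrite E ltxx.
  by move=> [/andP[-> xb] /eqP E]; rewrite lt_neqAle E.
- rewrite -[X in measurable X]setTI.
  exact: (measurable_enorm _ (measurable_set1 b)).
- exact: measurable_shell.
- exact: lebesgue_sphere.
Qed.

End Integration.

(** * Vanishing mean on shells *)

Section MeanZero.
Context {R : realType} {n : nat}.
Local Notation V := (n.-tuple R).
Implicit Types (a b r : R) (x y z : V) (g : V -> R).
Variables mu sig : {measure set V -> \bar R}.
Hypothesis n_gt0 : (0 < n)%N.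
Hypothesis mu_leb : is_lebesgue mu.
Hypothesis sig_surf : is_surface_measure mu sig.

Definition udir x : V := vscale (enorm x)^-1 x.

Lemma enorm_udir x : x != vzero -> enorm (udir x) = 1.
Proof.
rewrite -enorm_gt0 => x0.
by rewrite enorm_vscale ger0_norm ?invr_ge0 ?enorm_ge0// mulVf// gt_eqF.
Qed.

Lemma udirK x : vscale (enorm x) (udir x) = x.
Proof.
have [->|x0] := eqVneq x vzero.
  by apply: eq_from_tnth => i; rewrite !tnth_vscale !tnth_vzero !mulr0.
by rewrite vscaleA divff ?vscale1// enorm_eq0.
Qed.

Lemma udir_vscale r x : 0 < r -> udir (vscale r x) = udir x.
Proof.
move=> r0; rewrite /udir enorm_vscale gtr0_norm// vscaleA.
by rewrite invfM mulrAC mulVf ?mul1r// gt_eqF.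
Qed.

Let cone r (A : set V) : set V := [set y | 0 < enorm y <= r /\ A (udir y)].

Let measurable_cone r (A : set V) : measurable A -> measurable (cone r A).
Proof.
move=> mA; rewrite (_ : cone r A = [set y | 0 < enorm y <= r] `&` udir @^-1` A) //.
apply: measurableI; first exact: measurable_shell.
by rewrite -[X in measurable X]setTI; exact: measurable_unit_vector.
Qed.

Let surface_cone r (A : set V) : 0 < r -> measurable A ->
  sig A = ((n%:R / r ^+ n)%:E * mu (cone r A))%E.
Proof.
move=> r0 mA; rewrite (lebesgue_scale mu_leb r0); last exact: measurable_cone.
rewrite muleA -EFinM divfK ?gt_eqF ?exprn_gt0// sig_surf//.
congr (_ * mu _)%E; apply/seteqP; split => y /=.
  move=> [s [x [/andP[s0 s1] [Ax [Sx ->]]]]].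
  have Ey : vscale r (vscale s x) = vscale (r * s) x by rewrite vscaleA.
  rewrite /cone /= Ey enorm_vscale Sx mulr1 gtr0_norm ?mulr_gt0//=.
  rewrite udir_vscale ?mulr_gt0// /udir Sx invr1 vscale1; split=> //.
  by rewrite ger_pMr.
rewrite /cone /= => -[/andP[y0 y1] Ay].
move: y0 y1; rewrite enorm_vscale gtr0_norm// pmulr_rgt0// ger_pMr// => y0 y1.
exists (enorm y), (udir y); split; first by rewrite y0 y1.
split; first by rewrite -(udir_vscale y r0).
by split; [apply: enorm_udir; rewrite -enorm_gt0|rewrite udirK].
Qed.

Let phi r y : V := if 0 < enorm y <= r then udir y else vzero.

Let measurable_phi r : measurable_fun setT (phi r).
Proof.
apply: measurable_fun_if => //.
- rewrite (_ : (fun _ => _) = fun t => (0 < enorm t) && (enorm t <= r)) //.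
  by apply: measurable_and; [apply: measurable_fun_ltr|apply: measurable_fun_ler];
    rewrite //; exact: measurable_enorm.
- by apply: measurable_funTS; exact: measurable_unit_vector.
Qed.

Lemma polar_ge0 r g : 0 < r -> measurable_fun setT g -> (forall x, 0 <= g x) ->
  (\int[sig]_(x in sphere) (g x)%:E = (n%:R / r ^+ n)%:E *
     \int[mu]_(y in [set y | (0 < enorm y <= r)%R]) (g (udir y))%:E)%E.
Proof.
move=> r0 mg g0; have mph := measurable_phi r.
have k0 : 0 <= n%:R / r ^+ n by rewrite divr_ge0// exprn_ge0// ltW.
have mS : measurable (sphere : set V).
  rewrite -[X in measurable X]setTI.
  exact: (measurable_enorm measurableT (measurable_set1 1)).
have preS (A : set V) : A `<=` sphere -> phi r @^-1` A = cone r A.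
  move=> AS; apply/seteqP; split => y; rewrite /= /phi /cone /=.
    case: ifPn => // _ /AS; rewrite /sphere /= enorm_vzero => /eqP.
    by rewrite eq_sym oner_eq0.
  by move=> [-> ].
rewrite (eq_measure_integral (mscale (NngNum k0) (pushforward mu (phi r)))); last first.
  move=> A mA AS; rewrite /= /mscale /= /pushforward (preS _ AS).
  exact: surface_cone.
rewrite ge0_integral_mscale//; last first.
  by move=> x _; rewrite lee_fin.
  by apply/measurable_EFinP; exact: measurable_funTS.
congr (_ * _)%E; rewrite ge0_integral_pushforward//; last first.
  by move=> x _; rewrite lee_fin.
  by apply/measurable_EFinP; exact: measurable_funTS.
rewrite preS//.
have -> : cone r sphere = [set y | 0 < enorm y <= r].
  apply/seteqP; split => y; rewrite /cone /=; first by case.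
  by move=> /[dup] /andP[y0 _] ->; split => //; apply: enorm_udir; rewrite -enorm_gt0.
by apply: eq_integral => y /=; rewrite inE /= /phi => ->.
Qed.

Variables (Om : V -> R) (A : R).
Hypothesis mOm : measurable_fun setT Om.
Hypothesis Om_bound : forall y, y != vzero -> `|Om y| <= A.
Hypothesis Om_hom : forall r y, 0 < r -> y != vzero -> Om (vscale r y) = Om y.
Hypothesis Om_mean : \int[sig]_(x in sphere) Om x = 0.

Let A_ge0 : 0 <= A.
Proof.
have v0 : [tuple (1 : R) | i < n] != vzero.
  apply/eqP => /(congr1 (fun t => tnth t (Ordinal n_gt0))).
  by rewrite !tnth_mktuple => /eqP; rewrite oner_eq0.
exact: le_trans (normr_ge0 _) (Om_bound v0).
Qed.

Let Om_udir y : y != vzero -> Om (udir y) = Om y.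
Proof. by move=> y0; rewrite /udir Om_hom// invr_gt0 enorm_gt0. Qed.

Let ball_integrable r : mu.-integrable [set y | 0 < enorm y <= r] (EFin \o Om).
Proof.
apply: (@bounded_integrable R n mu mu_leb _ _ A) => //.
- exact: measurable_shell.
- exact: bounded_shell.
- by move=> y /= /andP[y0 _]; apply: Om_bound; rewrite -enorm_gt0.
Qed.

Lemma mean_zero_ball r : 0 < r -> \int[mu]_(y in [set y | 0 < enorm y <= r]) Om y = 0.
Proof.
move=> r0; pose k := n%:R / r ^+ n.
have k0 : 0 < k by rewrite divr_gt0 ?ltr0n// exprn_gt0.
set B := [set y : V | 0 < enorm y <= r].
have E : (\int[sig]_(x in sphere) (Om x)%:E = k%:E * \int[mu]_(y in B) (Om y)%:E)%E.
  rewrite integralE [in RHS]integralE muleBr//; last first.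
    apply: fin_num_adde_defr.
    exact: (integrable_pos_fin_num (measurable_shell 0 r) (ball_integrable r)).
  have pE : (EFin \o Om)^\+%E = EFin \o (fun x => Num.max (Om x) 0).
    exact: funerpos.
  have nE : (EFin \o Om)^\-%E = EFin \o (fun x => Num.max (- Om x) 0).
    exact: funerneg.
  rewrite pE nE /= (@polar_ge0 r (fun x => Num.max (Om x) 0))//; last 2 first.
  - exact: measurable_maxr.
  - by move=> x; rewrite le_max lexx orbT.
  rewrite (@polar_ge0 r (fun x => Num.max (- Om x) 0))//; last 2 first.
  - by apply: measurable_maxr => //; exact: measurable_funN.
  - by move=> x; rewrite le_max lexx orbT.
  congr (_ * _ - _ * _)%E; apply: eq_integral => y; rewrite inE /B /= => /andP[y0 _];
    by rewrite Om_udir// -enorm_gt0.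
move: Om_mean; rewrite /Rintegral E fineM//; last first.
  exact: (integrable_fin_num (measurable_shell 0 r) (ball_integrable r)).
by move/eqP; rewrite mulf_eq0 gt_eqF//= => /eqP.
Qed.

Lemma mean_zero_shell a b : 0 < a -> a <= b ->
  \int[mu]_(y in [set y | a < enorm y <= b]) Om y = 0.
Proof.
move=> a0 ab.
have := Rintegral_shell_split (ltW a0) ab (ball_integrable b).
by rewrite !mean_zero_ball ?(lt_le_trans a0)// add0r.
Qed.

Variable k : R.
Hypothesis k_ge0 : 0 <= k.
Let w y := enorm y `^ (- k).

Let mw : measurable_fun setT w.
Proof.
rewrite /w (_ : (fun _ => _) = (@powR R ^~ (- k)) \o @enorm R n)//.
by apply: measurableT_comp => //; exact: measurable_enorm.
Qed.

Let wOm_integrable a b : 0 < a -> 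
  mu.-integrable [set y | a < enorm y <= b] (EFin \o (fun y => w y * Om y)).
Proof.
move=> a0; apply: (@bounded_integrable R n mu mu_leb _ _ (a `^ (- k) * A)).
- exact: measurable_shell.
- exact: bounded_shell.
- exact: measurable_funM.
- move=> y /= /andP[ay _]; rewrite normrM ler_pM//.
    by rewrite ger0_norm ?powR_ge0// powRN_le// ltW.
  by apply: Om_bound; rewrite -enorm_gt0 (lt_trans a0).
Qed.

Let Om_integrable a b : 0 < a ->
  mu.-integrable [set y | a < enorm y <= b] (EFin \o Om).
Proof.
move=> a0; apply: (@bounded_integrable R n mu mu_leb _ _ A) => //.
- exact: measurable_shell.
- exact: bounded_shell.
- by move=> y /= /andP[ay _]; apply: Om_bound; rewrite -enorm_gt0 (lt_trans a0).
Qed.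

Let one_shell a b : 0 < a -> a <= b ->
  `|\int[mu]_(y in [set y | a < enorm y <= b]) (w y * Om y)| <=
  (a `^ (- k) - b `^ (- k)) * A * fine (mu [set y | a < enorm y <= b]).
Proof.
move=> a0 ab; set D := [set y | _].
have mD : measurable D by exact: measurable_shell.
have -> : \int[mu]_(y in D) (w y * Om y) =
    \int[mu]_(y in D) ((w y - a `^ (- k)) * Om y).
  rewrite [RHS](_ : _ = \int[mu]_(y in D) (w y * Om y - a `^ (- k) * Om y)).
    rewrite RintegralB//; [|exact: wOm_integrable|].
      by rewrite RintegralZl ?mean_zero_shell ?mulr0 ?subr0//; exact: Om_integrable.
    have := integrableZl mD (a `^ (- k)) (Om_integrable b a0).
    by apply: eq_integrable.
  by apply: eq_Rintegral => y _; rewrite mulrBl.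
apply: Rintegral_le_bound => //.
- exact: bounded_shell.
- by apply: measurable_funM => //; apply: measurable_funB.
- move=> y /= /andP[ay yb]; have y0 := lt_trans a0 ay.
  rewrite normrM ler_pM//; last by apply: Om_bound; rewrite -enorm_gt0.
  by rewrite ler0_norm ?opprB ?lerB ?subr_le0// powRN_le// ltW.
Qed.

(* On each shell of ratio [lam] the radial weight is constant up to a relative error
   [1 - lam `^ (- k)], and the constant part integrates to zero. *)
Let shells a lam m : 0 < a -> 1 <= lam ->
  `|\int[mu]_(y in [set y | a < enorm y <= a * lam ^+ m]) (w y * Om y)| <=
  (1 - lam `^ (- k)) * a `^ (- k) * A *
    fine (mu [set y | a < enorm y <= a * lam ^+ m]).
Proof.
move=> a0 lam1; have lam0 : 0 < lam by exact: lt_le_trans lam1.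
have lk1 : lam `^ (- k) <= 1.
  by have := powRN_le k_ge0 ltr01 lam1; rewrite powR1.
have lm1 m' : 1 <= lam ^+ m' by rewrite exprn_ege1.
elim: m => [|m IH].
  have -> : [set y : V | a < enorm y <= a * lam ^+ 0] = set0.
    apply/seteqP; split => y //=; rewrite expr0 mulr1 => /andP[ay ya].
    by have := lt_le_trans ay ya; rewrite ltxx.
  by rewrite Rintegral_set0 measure0 normr0 mulr0.
have a1 : 0 < a * lam ^+ m by rewrite mulr_gt0// exprn_gt0.
have le1 : a <= a * lam ^+ m by rewrite ler_peMr// ltW.
have le2 : a * lam ^+ m <= a * lam ^+ m.+1.
  by rewrite ler_pM2l// exprS ler_peMl// exprn_ge0// ltW.
rewrite (Rintegral_shell_split le1 le2 (wOm_integrable _ a0)).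
have -> : fine (mu [set y | a < enorm y <= a * lam ^+ m.+1]) =
   fine (mu [set y | a < enorm y <= a * lam ^+ m]) +
   fine (mu [set y | a * lam ^+ m < enorm y <= a * lam ^+ m.+1]).
  rewrite !(lebesgue_shell mu_leb)// ?(le_trans le1)//; ring.
rewrite mulrDr; apply: le_trans (ler_normD _ _) _; apply: lerD => //.
apply: le_trans (one_shell a1 le2) _.
rewrite ler_wpM2r ?fine_ge0// ler_wpM2r//.
have -> : a * lam ^+ m.+1 = lam * (a * lam ^+ m) by rewrite exprS; ring.
rewrite (powRM _ (ltW lam0) (ltW a1)).
rewrite [leLHS](_ : _ = (1 - lam `^ (- k)) * (a * lam ^+ m) `^ (- k)); last by ring.
by rewrite ler_wpM2l ?subr_ge0// powRN_le.
Qed.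

Lemma weighted_mean_zero a b : 0 < a -> a <= b ->
  \int[mu]_(y in [set y | a < enorm y <= b]) (enorm y `^ (- k) * Om y) = 0.
Proof.
move=> a0 ab; apply/eqP; rewrite -normr_le0; set I := `|_|.
have b0 : 0 < b := lt_le_trans a0 ab.
have l0 : 0 <= ln (b / a) by rewrite ln_ge0// ler_pdivlMr// mul1r.
pose c := k * ln (b / a) * a `^ (- k) * A * fine (mu [set y | a < enorm y <= b]).
have c0 : 0 <= c by rewrite !mulr_ge0// ?powR_ge0// fine_ge0.
have H m : I <= c / m.+1%:R.
  pose lam := expR (ln (b / a) / m.+1%:R).
  have lam1 : 1 <= lam by rewrite -(expR0 R) ler_expR divr_ge0.
  have lamm : a * lam ^+ m.+1 = b.
    rewrite -expRM_natr divfK ?pnatr_eq0// lnK ?posrE ?divr_gt0//.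
    by rewrite mulrC divfK// gt_eqF.
  have := shells m.+1 a0 lam1; rewrite lamm -/I => /le_trans; apply.
  rewrite /c -!mulrA [leRHS](_ : _ = k * ln (b / a) / m.+1%:R *
    (a `^ (- k) * (A * fine (mu [set y | a < enorm y <= b])))); last by ring.
  apply: ler_wpM2r; first by rewrite !mulr_ge0// ?powR_ge0// fine_ge0.
  rewrite /lam /powR gt_eqF ?expR_gt0// expRK.
  rewrite -(mulrA k); set t := ln _ / _; have := expR_ge1Dx (- k * t); lra.
apply/ler_addgt0Pr => e e0; rewrite add0r.
apply: le_trans (H (Num.truncn (c / e))) _.
rewrite ler_pdivrMr// mulrC -ler_pdivrMr//; apply: ltW.
exact: truncnS_gt.
Qed.

End MeanZero.

(** * Regularity of the angular part *)

Section Kernel.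
Context {R : realType} {n : nat}.
Local Notation V := (n.-tuple R).
Implicit Types (a b r : R) (x y z : V) (g : V -> R).

Lemma integral_ge_rect d (T : measurableType d) (m : {measure set T -> \bar R})
    (D B : set T) (f : T -> \bar R) (c : R) :
  (forall t : T, D t -> (0 <= f t)%E) -> measurable B -> B `<=` D -> 0 <= c ->
  (forall t : T, B t -> (c%:E <= f t)%E) ->
  (c%:E * m B <= \int[m]_(t in D) f t)%E.
Proof.
move=> f0 mB BD c0 cf; rewrite ge0_integralE//.
apply: ereal_sup_ubound.
exists (scale_nnsfun (indic_nnsfun R mB) c0); last first.
  rewrite -(sintegral_indic m B) -(@sintegralrM _ _ _ m c (indic_nnsfun R mB)).
  by [].
move=> x /=; rewrite patchE mindicE.
case: (pselect (B x)) => Bx.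
  by rewrite (mem_set Bx) (mem_set (BD _ Bx)) mulr1 cf.
rewrite (memNset Bx) mulr0.
by case: ifPn => // /set_mem; exact: f0.
Qed.

Lemma dini_holder (Om : V -> Cx R) (alpha : R) : 0 < alpha ->
  (\int[lebesgue_measure]_(d in `]0%R, 1%R] : set R)
     (omega_inf Om d * ((d `^ (1 + alpha))^-1)%:E) < +oo)%E ->
  exists C : R, 0 <= C /\ forall x y, enorm x = 1 -> enorm y = 1 ->
    enorm (vsub x y) <= 2^-1 ->
    cabs (csub (Om x) (Om y)) <= C * enorm (vsub x y) `^ alpha.
Proof.
move=> al0; set I := integral _ _ _ => Ioo.
have cabs0 (z w : Cx R) : 0 <= cabs (csub z w) by exact: sqrtr_ge0.
exists (2 `^ (1 + alpha) * `|fine I|); split.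
  by rewrite mulr_ge0// powR_ge0.
move=> x y x1 y1; set e := enorm (vsub x y) => e2.
have e0 : 0 <= e by exact: enorm_ge0.
move: e0; rewrite le_eqVlt => /predU1P[e0|e0].
  have -> : x = y.
    by apply/eqP; rewrite -[_ == _]negbK -enorm_vsub_gt0 -/e -e0 ltxx.
  rewrite /cabs /csub /= !subrr expr0n /= addr0 sqrtr0.
  by rewrite !mulr_ge0// powR_ge0.
set v := cabs _.
have om_ge d : e <= d -> (v%:E <= omega_inf Om d)%E.
  by move=> ed; apply: ereal_sup_ubound; exists x, y.
have om_ge0 d : 0 < d -> (0 <= omega_inf Om d)%E.
  move=> d0; apply: ereal_sup_ubound; exists x, x; split => //; split => //.
  rewrite (_ : vsub x x = vzero) ?enorm_vzero; last first.
    by apply: eq_from_tnth => i; rewrite tnth_vsub tnth_vzero subrr.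
  split; first exact: ltW.
  by congr (_%:E); rewrite /cabs /csub /= !subrr expr0n /= addr0 sqrtr0.
have H : ((v * ((2 * e) `^ (1 + alpha))^-1)%:E * (lebesgue_measure `]e, (2 * e)%R])
    <= I)%E.
  apply: integral_ge_rect => //.
  - move=> d /=; rewrite in_itv /= => /andP[d0 _].
    by rewrite mule_ge0 ?om_ge0// lee_fin invr_ge0 powR_ge0.
  - move=> d /=; rewrite !in_itv /= => /andP[ed d2e].
    by rewrite (lt_trans e0 ed) /=; lra.
  - by rewrite mulr_ge0 ?cabs0// invr_ge0 powR_ge0.
  - move=> d /=; rewrite in_itv /= => /andP[ed d2e]; have d0 := lt_trans e0 ed.
    rewrite EFinM; apply: lee_pmul.
    + by rewrite lee_fin cabs0.
    + by rewrite lee_fin invr_ge0 powR_ge0.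
    + exact/om_ge/ltW.
    + rewrite lee_fin lef_pV2 ?posrE ?powR_gt0// ?mulr_gt0//.
      by apply: ge0_ler_powR; rewrite ?nnegrE //; lra.
have I0 : (0 <= I)%E.
  apply: le_trans H; rewrite mule_ge0// lee_fin mulr_ge0 ?cabs0//.
  by rewrite invr_ge0 powR_ge0.
have If : I \is a fin_num by rewrite ge0_fin_numE.
move: H; rewrite lebesgue_measure_itv /= lte_fin ifT; last by lra.
rewrite -EFinB -EFinM -(fineK If) lee_fin => H.
have H' : v <= fine I * ((2 * e) `^ (1 + alpha)) / e.
  rewrite ler_pdivlMr// -ler_pdivrMr ?powR_gt0 ?mulr_gt0//.
  by apply: le_trans H; rewrite le_eqVlt; apply/orP; left; apply/eqP; ring.
apply: le_trans H' _; rewrite (powRM _ (ler0n R 2) (ltW e0)).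
have -> : e `^ (1 + alpha) = e * e `^ alpha.
  rewrite powRD ?powRr1 ?(ltW e0)//.
  by apply/implyP => _; rewrite gt_eqF.
rewrite (ger0_norm (fine_ge0 I0)).
suff -> : fine I * (2 `^ (1 + alpha) * (e * e `^ alpha)) / e =
  2 `^ (1 + alpha) * fine I * e `^ alpha by [].
by field; rewrite gt_eqF.
Qed.

Lemma sphere_bounded (G : V -> R) (C alpha : R) : (0 < n)%N -> 0 <= alpha -> 0 <= C ->
  (forall x y, enorm x = 1 -> enorm y = 1 -> enorm (vsub x y) <= 2^-1 ->
    `|G x - G y| <= C * enorm (vsub x y) `^ alpha) ->
  exists A : R, 0 <= A /\ forall x, enorm x = 1 -> `|G x| <= A.
Proof.
move=> n0 al0 C0 GC.
pose N := (2 * n)%N.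
have N0 : (0 < N%:R :> R) by rewrite ltr0n muln_gt0.
pose code x : {ffun 'I_n -> 'I_(2 * N).+1} :=
  [ffun i => inord (Num.truncn ((tnth x i + 1) * N%:R))].
have codeP x i : enorm x = 1 ->
    (code x i)%:R <= (tnth x i + 1) * N%:R < (code x i)%:R + 1.
  move=> x1; have := le_tnth_enorm x i; rewrite x1 ler_norml => /andP[xl xr].
  have t0 : 0 <= (tnth x i + 1) * N%:R by apply: mulr_ge0 => //; lra.
  rewrite ffunE inordK.
    by rewrite natr1; exact: truncn_itv.
  rewrite ltnS -(ler_nat R); apply: (@le_trans _ _ ((tnth x i + 1) * N%:R)).
    by rewrite truncn_le.
  by rewrite natrM ler_pM2r//; lra.
pose rep (c : {ffun 'I_n -> 'I_(2 * N).+1}) : V :=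
  xget vzero [set x | enorm x = 1 /\ code x = c].
exists (\sum_c `|G (rep c)| + C); split; first by rewrite addr_ge0// sumr_ge0.
move=> x x1.
have [y1 cy] : enorm (rep (code x)) = 1 /\ code (rep (code x)) = code x.
  by apply: (@xgetPex _ vzero [set z | enorm z = 1 /\ code z = code x]); exists x.
set y := rep (code x) in y1 cy *.
have xy : enorm (vsub x y) <= 2^-1.
  have -> : 2^-1 = n%:R * N%:R^-1 :> R.
    rewrite /N natrM invfM mulrC -mulrA mulVf ?mulr1//.
    by rewrite pnatr_eq0 -lt0n.
  apply: enorm_le_max => i; rewrite tnth_vsub.
  rewrite -(@ler_pM2r _ N%:R)// mulVf ?gt_eqF// -[X in _ * X <= _]gtr0_norm//.
  rewrite -normrM ler_norml.
  have /andP[] := codeP x i x1; have /andP[] := codeP y i y1; rewrite cy; lra.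
have -> : G x = (G x - G y) + G y by rewrite subrK.
apply: le_trans (ler_normD _ _) _; rewrite addrC; apply: lerD.
  by rewrite (bigD1 (code x))//= lerDl sumr_ge0.
apply: le_trans (GC x y x1 y1 xy) _.
rewrite ler_piMr//; have := enorm_ge0 (vsub x y).
rewrite le_eqVlt => /predU1P[<-|e0].
  by have [->|a0] := eqVneq alpha 0; rewrite ?powRr0// powR0.
have e1 : enorm (vsub x y) <= 1 by lra.
have := @ger_powR R (enorm (vsub x y)) _ 0 alpha al0.
by rewrite powRr0; apply; rewrite e0.
Qed.

Lemma enorm_udirB x y : x != vzero -> y != vzero ->
  enorm (vsub (udir x) (udir y)) <= 2 * (enorm (vsub x y) / enorm x).
Proof.
move=> x0 y0; have nx : 0 < enorm x by rewrite enorm_gt0.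
have ny : 0 < enorm y by rewrite enorm_gt0.
pose m := vscale (enorm x)^-1 y.
apply: le_trans (enorm_triangle m _ _) _; rewrite mulrDl mul1r lerD//.
  have -> : vsub (udir x) m = vscale (enorm x)^-1 (vsub x y).
    by apply: eq_from_tnth => i; rewrite !(tnth_vsub, tnth_vscale); ring.
  by rewrite enorm_vscale gtr0_norm ?invr_gt0// mulrC.
have -> : vsub (udir y) m = vscale ((enorm y)^-1 - (enorm x)^-1) y.
  by apply: eq_from_tnth => i; rewrite !(tnth_vsub, tnth_vscale); ring.
rewrite enorm_vscale -{2}(gtr0_norm ny) -normrM.
have -> : ((enorm y)^-1 - (enorm x)^-1) * enorm y = (enorm x - enorm y) / enorm x.
  by field; rewrite !gt_eqF.
rewrite normrM [X in _ * X]gtr0_norm ?invr_gt0// ler_pM2r ?invr_gt0//.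
rewrite ler_norml; have := enorm_vsub_ge x y; have := enorm_vsub_ge y x.
rewrite (enormB y); lra.
Qed.

Lemma hom_holder (G : V -> R) (C alpha : R) : 0 < alpha <= 1 -> 0 <= C ->
  (forall r y, 0 < r -> y != vzero -> G (vscale r y) = G y) ->
  (forall x y, enorm x = 1 -> enorm y = 1 -> enorm (vsub x y) <= 2^-1 ->
    `|G x - G y| <= C * enorm (vsub x y) `^ alpha) ->
  forall x y, x != vzero -> y != vzero -> 4 * enorm (vsub x y) <= enorm x ->
    `|G x - G y| <= 2 * C * (enorm (vsub x y) / enorm x) `^ alpha.
Proof.
move=> /andP[al0 al1] C0 homG GC x y x0 y0 xy.
have nx : 0 < enorm x by rewrite enorm_gt0.
have ny : 0 < enorm y by rewrite enorm_gt0.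
rewrite -(homG (enorm x)^-1 x) ?invr_gt0// -(homG (enorm y)^-1 y) ?invr_gt0//.
rewrite -/(udir x) -/(udir y).
have d0 : 0 <= enorm (vsub x y) / enorm x by rewrite divr_ge0// enorm_ge0.
have d1 : enorm (vsub x y) / enorm x <= 4^-1.
  by rewrite ler_pdivrMr//; lra.
have U := enorm_udirB x0 y0.
apply: le_trans (GC _ _ (enorm_udir x0) (enorm_udir y0) _) _; first lra.
rewrite [2 * C]mulrC -mulrA ler_wpM2l//.
apply: (@le_trans _ _ ((2 * (enorm (vsub x y) / enorm x)) `^ alpha)).
  apply: ge0_ler_powR => //; [exact: ltW| |]; rewrite nnegrE ?enorm_ge0//.
  exact: mulr_ge0.
rewrite powRM// ler_wpM2r ?powR_ge0//.
by apply: ler1_powR => //; lra.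
Qed.

Lemma bernoulli_le (u : R) (m : nat) : 0 <= u -> 1 - m%:R * (1 - u) <= u ^+ m.
Proof.
move=> u0; elim: m => [|m IH]; first by rewrite mul0r subr0 expr0.
rewrite exprS -natr1; have m0 : 0 <= m%:R :> R by [].
have : u * (1 - m%:R * (1 - u)) <= u * u ^+ m by rewrite ler_wpM2l.
have : 0 <= m%:R * (1 - u) ^+ 2 by rewrite mulr_ge0// sqr_ge0.
set c : R := m%:R; move: (u * u ^+ m) => v; rewrite expr2; lra.
Qed.

Lemma exprB_le (a b : R) (m : nat) : 0 <= a -> 0 < b ->
  b ^+ m - a ^+ m <= m%:R * ((b - a) / b) * b ^+ m.
Proof.
move=> a0 b0; have := bernoulli_le m (divr_ge0 a0 (ltW b0)).
have -> : (b - a) / b = 1 - a / b by field; rewrite gt_eqF.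
rewrite -(@ler_pM2r _ (b ^+ m)) ?exprn_gt0// -exprMn divfK ?gt_eqF//.
by rewrite mulrBl mul1r; lra.
Qed.

Lemma powRN_lip (s t k : R) : 0 < s -> s <= t -> 0 <= k <= n%:R ->
  s `^ (- k) - t `^ (- k) <= s `^ (- k) * (n%:R * ((t - s) / t)).
Proof.
move=> s0 st /andP[k0 kn]; have t0 := lt_le_trans s0 st.
have u0 : 0 < s / t by rewrite divr_gt0.
have u1 : s / t <= 1 by rewrite ler_pdivrMr// mul1r.
have -> : t `^ (- k) = s `^ (- k) * (s / t) `^ k.
  rewrite powRM ?invr_ge0 ?ltW// -(powR_inv1 (ltW t0)) -powRrM mulN1r.
  rewrite mulrA -powRD ?addNr ?powRr0 ?mul1r//.
  by apply/implyP => _; rewrite gt_eqF.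
rewrite -[X in X - _]mulr1 -mulrBr ler_wpM2l ?powR_ge0//.
have ukn : (s / t) ^+ n <= (s / t) `^ k.
  by rewrite -(powR_mulrn _ (ltW u0)) ger_powR// u0.
have := bernoulli_le n (ltW u0).
have -> : (t - s) / t = 1 - s / t by field; rewrite gt_eqF.
lra.
Qed.

End Kernel.

(** * Mean oscillation *)

Section Campanato.
Context {R : realType} {n : nat}.
Local Notation V := (n.-tuple R).
Implicit Types (r s t : R) (x y z : V).
Variable mu : {measure set V -> \bar R}.
Hypothesis mu_leb : is_lebesgue mu.

Definition ccube x s : set V := cube [tuple tnth x i - s | i < n] (2 * s).

Lemma ccubeP x s y : ccube x s y <->
  forall i, tnth x i - s <= tnth y i < tnth x i + s.
Proof.
split => H i; have := H i; rewrite tnth_mktuple.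
  by rewrite (_ : _ - s + 2 * s = tnth x i + s)//; ring.
by rewrite (_ : _ - s + 2 * s = tnth x i + s)//; ring.
Qed.

Lemma ccube_enorm x s y : ccube x s y -> enorm (vsub y x) <= n%:R * s.
Proof.
move=> /ccubeP H; apply: enorm_le_max => i; rewrite tnth_vsub ler_norml.
have := H i; lra.
Qed.

Lemma enorm_ccube x s y : enorm (vsub y x) < s -> ccube x s y.
Proof.
move=> H; apply/ccubeP => i; have := le_lt_trans (le_tnth_enorm (vsub y x) i) H.
rewrite tnth_vsub ltr_norml; lra.
Qed.

Lemma bounded_ccube x s : ebounded (ccube x s).
Proof.
exists (n%:R * s + enorm x) => y /= /ccube_enorm H.
have := enorm_vsub_ge y x; lra.
Qed.

Lemma measurable_ccube x s : measurable (ccube x s).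
Proof. exact: measurable_cube. Qed.

Lemma lebesgue_ccube x s : 0 <= s -> fine (mu (ccube x s)) = (2 * s) ^+ n.
Proof. by move=> s0; rewrite (lebesgue_cube mu_leb)// mulr_ge0. Qed.

Variables (f : V -> R) (L gam : R).
Hypothesis mf : measurable_fun setT f.
Hypothesis L_ge0 : 0 <= L.
Hypothesis gam_ge0 : 0 <= gam.
Hypothesis f_lip : forall x y, `|f x - f y| <= L * enorm (vsub x y) `^ gam.

Lemma lip_locally_bounded r : exists C, 0 <= C /\ forall y, enorm y <= r -> `|f y| <= C.
Proof.
exists (`|f vzero| + L * r `^ gam); split.
  by rewrite addr_ge0// mulr_ge0// powR_ge0.
move=> y yr; have -> : f y = f vzero + (f y - f vzero) by rewrite addrC subrK.
apply: le_trans (ler_normD _ _) _; rewrite lerD2l.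
apply: le_trans (f_lip _ _) _; rewrite ler_wpM2l// vsubx0.
by apply: powR_le => //; exact: enorm_ge0.
Qed.

Lemma osc_integrable (D : set V) a : measurable D -> ebounded D ->
  mu.-integrable D (EFin \o (fun y => `|f y - a|)).
Proof.
move=> mD bD; case: (bD) => r Dr; have [C [C0 fC]] := lip_locally_bounded r.
apply: (@bounded_integrable R n mu mu_leb _ _ (C + `|a|)) => //.
  by apply: measurableT_comp => //; exact: measurable_funB.
move=> y /Dr yr; rewrite normr_id; apply: le_trans (ler_normB _ _) _.
by rewrite lerD2r fC.
Qed.

Lemma osc_subset (D E : set V) a : measurable D -> measurable E ->
  ebounded E -> D `<=` E ->
  \int[mu]_(y in D) `|f y - a| <= \int[mu]_(y in E) `|f y - a|.
Proof.
move=> mD mE bE DE.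
have bD : ebounded D by case: bE => r Er; exists r => y /DE /Er.
apply: fine_le.
- exact: integrable_fin_num (osc_integrable _ _ _).
- exact: integrable_fin_num (osc_integrable _ _ _).
apply: ge0_subset_integral => //.
apply/measurable_EFinP; apply: measurable_funTS.
by apply: measurableT_comp => //; exact: measurable_funB.
Qed.

Lemma osc_change (D : set V) a b : measurable D -> ebounded D ->
  \int[mu]_(y in D) `|f y - a| <=
  \int[mu]_(y in D) `|f y - b| + `|b - a| * fine (mu D).
Proof.
move=> mD bD; rewrite -Rintegral_cst// -RintegralD//.
- apply: le_Rintegral => //.
  + exact: osc_integrable.
  + apply: integrable_addR => //; first exact: osc_integrable.
    by apply: (@bounded_integrable R n mu mu_leb _ _ `|b - a|) => // y _;
      rewrite normr_id.
  + move=> y _; rewrite (_ : f y - a = (f y - b) + (b - a)) ?ler_normD//; ring.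
- exact: osc_integrable.
- by apply: (@bounded_integrable R n mu mu_leb _ _ `|b - a|) => // y _; rewrite normr_id.
Qed.

Lemma osc_cst (D : set V) a b : measurable D -> ebounded D ->
  `|b - a| * fine (mu D) <=
  \int[mu]_(y in D) `|f y - a| + \int[mu]_(y in D) `|f y - b|.
Proof.
move=> mD bD; rewrite -Rintegral_cst// -RintegralD//; try exact: osc_integrable.
apply: le_Rintegral => //.
- by apply: (@bounded_integrable R n mu mu_leb _ _ `|b - a|) => // y _; rewrite normr_id.
- by apply: integrable_addR => //; exact: osc_integrable.
- move=> y _; rewrite (_ : b - a = (f y - a) - (f y - b)) ?ler_normB//; ring.
Qed.

Variables (M eta : R).
Hypothesis M_ge0 : 0 <= M.
Hypothesis eta_itv : 0 <= eta <= 1.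
Hypothesis f_camp : forall x s, 0 < s -> exists a,
  \int[mu]_(y in ccube x s) `|f y - a| <= M * s `^ eta * s ^+ n.

Variable D : R.
Hypothesis D_gt1 : 1 < D.

Definition chain_const := 1 + 2 ^+ n * (2 / (D - 1)).

Lemma chain_const_ge0 : 0 <= chain_const.
Proof.
rewrite addr_ge0// mulr_ge0// ?exprn_ge0// divr_ge0// subr_ge0 ltW//.
Qed.

Lemma chain_cube x s : 0 < s -> exists a, forall k,
  \int[mu]_(y in ccube x (2 ^+ k * s)) `|f y - a| <=
  chain_const * D ^+ k * M * (2 ^+ k * s) `^ eta * (2 ^+ k * s) ^+ n.
Proof.
move=> s0; have [et0 et1] := andP eta_itv.
have pos k : 0 < 2 ^+ k * s by rewrite mulr_gt0// exprn_gt0.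
have /choice [a aP] : forall k, exists a,
    \int[mu]_(y in ccube x (2 ^+ k * s)) `|f y - a| <=
    M * (2 ^+ k * s) `^ eta * (2 ^+ k * s) ^+ n.
  by move=> k; exact: f_camp.
exists (a 0%N) => k.
have [C [C0 CE CC]] : exists C, [/\ 0 < C, C * D = C + 2 &
    chain_const = 1 + 2 ^+ n * C].
  exists (2 / (D - 1)); split=> //; first by rewrite divr_gt0// subr_gt0.
  by field; rewrite subr_eq0 gt_eqF.
have D0 : 0 < D by rewrite (lt_trans ltr01).
have Dk m : 1 <= D ^+ m by rewrite exprn_ege1// ltW.
have step m : `|a m.+1 - a m| <= 2 * M * (2 ^+ m.+1 * s) `^ eta.
  set r := 2 ^+ m * s; have r0 : 0 < r by exact: pos.
  have E2 : 2 ^+ m.+1 * s = 2 * r by rewrite exprS mulrA.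
  have H1 := osc_cst (a m) (a m.+1) (measurable_ccube x r) (bounded_ccube x r).
  have H2 : \int[mu]_(y in ccube x r) `|f y - a m.+1| <=
      \int[mu]_(y in ccube x (2 * r)) `|f y - a m.+1|.
    apply: osc_subset; [exact: measurable_ccube|exact: measurable_ccube|
      exact: bounded_ccube|].
    by move=> y /ccubeP H; apply/ccubeP => i; have := H i; lra.
  have := aP m.+1; have := aP m; rewrite -/r E2 => H3 H4.
  move: H1; rewrite lebesgue_ccube ?(ltW r0)// => H1.
  have rn : r ^+ n <= (2 * r) ^+ n.
    by rewrite lerXn2r// ?nnegrE ?mulr_ge0 ?(ltW r0)//; lra.
  have re : r `^ eta <= (2 * r) `^ eta by apply: powR_le => //; lra.
  have H5 : M * r `^ eta * r ^+ n <= M * (2 * r) `^ eta * (2 * r) ^+ n.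
    rewrite -!mulrA ler_wpM2l// ler_pM// ?powR_ge0// exprn_ge0//; exact: ltW.
  rewrite -(@ler_pM2r _ ((2 * r) ^+ n)) ?exprn_gt0 ?mulr_gt0//.
  rewrite [leRHS](_ : _ = M * (2 * r) `^ eta * (2 * r) ^+ n +
    M * (2 * r) `^ eta * (2 * r) ^+ n); last by ring.
  apply: le_trans H1 _; apply: lerD; first exact: le_trans H3 H5.
  exact: le_trans H2 H4.
have chain m : `|a m - a 0%N| <= C * D ^+ m * M * (2 ^+ m * s) `^ eta.
  elim: m => [|m IH].
    by rewrite subrr normr0; apply: mulr_ge0; [apply: mulr_ge0 => //;
      apply: mulr_ge0; [exact: ltW|rewrite expr0]|exact: powR_ge0].
  have -> : a m.+1 - a 0%N = (a m.+1 - a m) + (a m - a 0%N) by ring.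
  apply: le_trans (ler_normD _ _) _.
  have := step m; set p := (2 ^+ m.+1 * s) `^ eta => H1.
  have pp : (2 ^+ m * s) `^ eta <= p.
    apply: powR_le => //; first exact: ltW.
    by rewrite exprS -mulrA ler_peMl ?ler1n//; exact/ltW/pos.
  have H2 : C * D ^+ m * M * (2 ^+ m * s) `^ eta <= C * D ^+ m * M * p.
    by rewrite ler_wpM2l// !mulr_ge0 ?exprn_ge0 ?(ltW D0) ?(ltW C0).
  have p0 : 0 <= M * p by rewrite mulr_ge0// powR_ge0.
  have H3 : M * p <= D ^+ m * (M * p) by rewrite ler_peMl.
  have -> : C * D ^+ m.+1 * M * p = (C * D) * (D ^+ m * (M * p)) by rewrite exprS; ring.
  rewrite CE; have -> : (C + 2) * (D ^+ m * (M * p)) =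
    C * D ^+ m * M * p + 2 * (D ^+ m * (M * p)) by ring.
  lra.
set r := 2 ^+ k * s; have r0 : 0 < r by exact: pos.
have := osc_change (a 0%N) (a k) (measurable_ccube x r) (bounded_ccube x r).
move=> /le_trans; apply; rewrite lebesgue_ccube ?(ltW r0)//.
have H1 := aP k; rewrite -/r in H1; have H2 := chain k; rewrite -/r in H2.
set p := r `^ eta in H1 H2 *.
have p0 : 0 <= M * p * r ^+ n by rewrite !mulr_ge0// ?powR_ge0// exprn_ge0// ltW.
have H3 : M * p * r ^+ n <= D ^+ k * (M * p * r ^+ n) by rewrite ler_peMl.
have H4 : `|a k - a 0%N| * (2 * r) ^+ n <= C * D ^+ k * M * p * (2 * r) ^+ n.
  by rewrite ler_wpM2r// exprn_ge0// mulr_ge0// ltW.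
have -> : chain_const * D ^+ k * M * p * r ^+ n =
  D ^+ k * (M * p * r ^+ n) + C * D ^+ k * M * p * (2 * r) ^+ n.
  by rewrite CC (exprMn _ 2 r); ring.
lra.
Qed.

Lemma osc_ball_le_cube x r a : 0 < r ->
  \int[mu]_(y in [set y | enorm y <= r]) `|f (vsub x y) - a| <=
  \int[mu]_(y in ccube x (2 * r)) `|f y - a|.
Proof.
move=> r0; set B := [set y | _].
have mB : measurable B by exact: measurable_ball_le.
have mB' : measurable (vsub x @^-1` B).
  by rewrite -[X in measurable X]setTI; exact: measurable_vsub.
have bB' : ebounded (vsub x @^-1` B).
  exists (r + enorm x) => y /=; rewrite /B /= => H.
  have := enorm_vsub_ge y x; rewrite (enormB y); lra.
have mg : measurable_fun setT (fun y => `|f y - a|).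
  by apply: measurableT_comp => //; exact: measurable_funB.
have E : vsub x @^-1` (vsub x @^-1` B) = B.
  by apply/seteqP; split => y /=; rewrite vsubK.
rewrite /Rintegral -{1}E (@integral_reflect R n mu mu_leb x _ _ mB' mg)//.
apply: (@osc_subset _ _ a) => //; [exact: measurable_ccube|exact: bounded_ccube|].
move=> y; rewrite /B /= enormB => H; apply: enorm_ccube; lra.
Qed.

Lemma chain_ball x s : 0 < s -> exists a, forall k,
  \int[mu]_(y in [set y | enorm y <= 2 ^+ k * s]) `|f (vsub x y) - a| <=
  2 ^+ n.+1 * chain_const * D ^+ k * M * (2 ^+ k * s) `^ eta * (2 ^+ k * s) ^+ n.
Proof.
move=> s0; have [et0 et1] := andP eta_itv.
have [a aP] := chain_cube x (mulr_gt0 (ltr0n R 2) s0); exists a => k.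
set r := 2 ^+ k * s; have r0 : 0 < r by rewrite mulr_gt0// exprn_gt0.
apply: le_trans (osc_ball_le_cube x a r0) _.
have := aP k; have -> : 2 ^+ k * (2 * s) = 2 * r by rewrite /r; ring.
move=> /le_trans; apply; rewrite (exprMn _ 2 r).
have H : (2 * r) `^ eta <= 2 * r `^ eta.
  by apply: (@powR_scale _ 2 r eta 1) => //; [rewrite ler1n|exact: ltW].
have c0 : 0 <= chain_const * D ^+ k * M.
  by rewrite !mulr_ge0 ?chain_const_ge0// exprn_ge0// ltW// (lt_trans ltr01).
rewrite [leRHS](_ : _ = chain_const * D ^+ k * M * (2 * r `^ eta) * (2 ^+ n * r ^+ n)).
  rewrite ler_wpM2r ?mulr_ge0 ?exprn_ge0// ?(ltW r0)//.
  by rewrite ler_wpM2l.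
by rewrite exprS; ring.
Qed.

Lemma camp_growth x a : exists E, 0 <= E /\ forall k y, enorm y < 2 ^+ k ->
  `|f (vsub x y) - a| <= E * D ^+ k * (2 ^+ k) `^ eta.
Proof.
have [et0 et1] := andP eta_itv.
have D0 : 0 < D by rewrite (lt_trans ltr01).
have Dk m : 1 <= D ^+ m by rewrite exprn_ege1// ltW.
have [ax axP] := chain_cube x (@ltr01 R).
have [C [C0 CE]] : exists C, 0 <= C /\ C = chain_const * M.
  by eexists; split; last reflexivity; rewrite mulr_ge0// chain_const_ge0.
have [E1 [E10 E1E]] : exists E1, 0 <= E1 /\ E1 = L * n%:R `^ gam + C.
  by eexists; split; last reflexivity; rewrite addr_ge0// mulr_ge0// powR_ge0.
exists (E1 + C * (1 + 2 * D) * 2 ^+ n + `|ax - a|); split.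
  rewrite addr_ge0// addr_ge0// mulr_ge0 ?exprn_ge0// mulr_ge0// addr_ge0//.
  by rewrite mulr_ge0// ltW.
move=> k y yk; set w := vsub x y.
have [aw awP] := chain_cube w (@ltr01 R).
set P := (2 ^+ k) `^ eta.
have P1 : 1 <= P.
  have := @ler_powR R (2 ^+ k) _ 0 eta et0; rewrite powRr0; apply.
  by rewrite exprn_ege1// ler1n.
have H1 : `|f w - aw| <= E1.
  have := osc_cst aw (f w) (measurable_ccube w 1) (bounded_ccube w 1).
  rewrite lebesgue_ccube// mulr1 => H.
  have Ha := awP 0%N; rewrite !expr0 !mul1r !mulr1 powR1 expr1n !mulr1 in Ha.
  have Hb : \int[mu]_(y0 in ccube w 1) `|f y0 - f w| <= L * n%:R `^ gam * 2 ^+ n.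
    have <- : fine (mu (ccube w 1)) = 2 ^+ n by rewrite lebesgue_ccube// mulr1.
    apply: le_trans (ler_norm _) _.
    apply: (Rintegral_le_bound mu_leb) => //.
    - exact: measurable_ccube.
    - exact: bounded_ccube.
    - by apply: measurableT_comp => //; exact: measurable_funB.
    - move=> v /ccube_enorm; rewrite mulr1 normr_id => vn.
      apply: le_trans (f_lip _ _) _; rewrite ler_wpM2l//.
      by apply: powR_le => //; exact: enorm_ge0.
  have n1 : 1 <= 2 ^+ n :> R by rewrite exprn_ege1// ler1n.
  rewrite -(@ler_pM2r _ (2 ^+ n)) ?exprn_gt0//.
  have : C <= C * 2 ^+ n by rewrite ler_peMr.
  rewrite E1E mulrDl; rewrite -CE in Ha; lra.
have H2 : `|aw - ax| <= C * (1 + 2 * D) * 2 ^+ n * (D ^+ k * P).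
  set r : R := 2 ^+ k; have r0 : 0 < r by rewrite exprn_gt0.
  have := osc_cst ax aw (measurable_ccube x r) (bounded_ccube x r).
  rewrite lebesgue_ccube ?(ltW r0)// => H.
  have Ha := axP k; rewrite mulr1 -/r -/P in Ha.
  have Hb := awP k.+1; rewrite mulr1 exprS -/r in Hb.
  have Hc : \int[mu]_(y0 in ccube x r) `|f y0 - aw| <=
      \int[mu]_(y0 in ccube w (2 * r)) `|f y0 - aw|.
    apply: osc_subset; [exact: measurable_ccube|exact: measurable_ccube|
      exact: bounded_ccube|].
    move=> v /ccubeP Hv; apply/ccubeP => i; have := Hv i.
    have := le_lt_trans (le_tnth_enorm y i) yk.
    rewrite /w tnth_vsub ltr_norml -/r; lra.
  have Hd : (2 * r) `^ eta <= 2 * P.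
    by apply: (@powR_scale _ 2 r eta 1) => //; [rewrite ler1n|exact: ltW].
  have n1 : 1 <= 2 ^+ n :> R by rewrite exprn_ege1// ler1n.
  have rn : 0 < r ^+ n by rewrite exprn_gt0.
  have q0 : 0 <= C * (D ^+ k * P) * r ^+ n.
    by rewrite !mulr_ge0// ?powR_ge0// ltW// exprn_gt0.
  rewrite -(@ler_pM2r _ ((2 * r) ^+ n)) ?exprn_gt0 ?mulr_gt0//.
  apply: le_trans H _.
  apply: (@le_trans _ _ (C * (D ^+ k * P) * r ^+ n * 1 +
      C * (D * (D ^+ k * P)) * 2 * (r ^+ n * 2 ^+ n) * 1)).
    apply: lerD.
      suff <- : chain_const * D ^+ k * M * P * r ^+ n =
        C * (D ^+ k * P) * r ^+ n * 1 by [].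
      by rewrite CE; ring.
    apply: le_trans Hc _; apply: le_trans Hb _.
    rewrite [leRHS](_ : _ = chain_const * D ^+ k.+1 * M * (2 * P) * (2 * r) ^+ n).
      rewrite ler_wpM2r ?exprn_ge0 ?mulr_ge0 ?(ltW r0)// ler_wpM2l//.
      by rewrite !mulr_ge0 ?chain_const_ge0// exprn_ge0// ltW.
    by rewrite (exprMn _ 2 r) exprS CE; ring.
  rewrite (exprMn _ 2 r) [leRHS](_ : _ = C * (D ^+ k * P) * r ^+ n * (2 ^+ n * 2 ^+ n) +
     C * (D * (D ^+ k * P)) * 2 * (r ^+ n * 2 ^+ n) * 2 ^+ n); last by ring.
  apply: lerD; apply: ler_wpM2l => //.
    by rewrite mulr_ege1.
  by rewrite !mulr_ge0// ?powR_ge0// ltW// exprn_gt0.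
have q1 : 1 <= D ^+ k * P by rewrite mulr_ege1.
have -> : f w - a = (f w - aw) + (aw - ax) + (ax - a) by ring.
apply: le_trans (ler_normD _ _) _; rewrite -mulrA mulrDl mulrDl.
apply: lerD; last by rewrite ler_peMr.
apply: le_trans (ler_normD _ _) _; apply: lerD => //.
by apply: le_trans H1 _; rewrite ler_peMr.
Qed.

End Campanato.

(** * The difference estimate *)

Lemma powRN_diff (R : realType) (n : nat) (h y t k : R) : 0 <= h -> 4 * h <= y ->
  y - h <= t -> t <= y + h -> 0 < y -> 0 <= k <= n%:R ->
  `|y `^ (- k) - t `^ (- k)| <= n%:R * 2 ^+ n * (h / y * y `^ (- k)).
Proof.
move=> h0 hy ty yt y0 kn; have [k0 _] := andP kn; have t0 : 0 < t by lra.
have Q (v w : R) : 0 < v -> v <= w -> y <= 2 * v -> y <= w -> w - v <= h ->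
    v `^ (- k) - w `^ (- k) <= n%:R * 2 ^+ n * (h / y * y `^ (- k)).
  move=> v0 vw yv yw wve; have w0 : 0 < w by lra.
  have wv0 : 0 <= w - v by lra.
  apply: le_trans (powRN_lip v0 vw kn) _.
  have le1 : (w - v) / w <= h / y.
    by apply: ler_pM; rewrite ?invr_ge0 ?(ltW w0)// lef_pV2 ?posrE.
  rewrite [leRHS](_ : _ = (2 ^+ n * y `^ (- k)) * (n%:R * (h / y))); last by ring.
  apply: ler_pM; [exact: powR_ge0|by rewrite mulr_ge0// divr_ge0// ltW| |].
    by apply: powRN_scale => //; rewrite ler1n.
  exact: ler_wpM2l.
have [le|/ltW le] := leP y t.
  rewrite ger0_norm ?subr_ge0 ?(powRN_le k0 y0 le)//; apply: Q => //; lra.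
rewrite ler0_norm ?subr_le0 ?(powRN_le k0 t0 le)// opprB; apply: Q => //; lra.
Qed.

Section SingularIntegral.
Context {R : realType} {n : nat}.
Local Notation V := (n.-tuple R).
Implicit Types (a b c r s : R) (x y z e : V).
Variable mu : {measure set V -> \bar R}.
Hypothesis n_gt0 : (0 < n)%N.
Hypothesis mu_leb : is_lebesgue mu.

Variables (Om : V -> R) (A alpha gam beta : R).
Hypothesis mOm : measurable_fun setT Om.
Hypothesis A_ge0 : 0 <= A.
Hypothesis Om_bound : forall y, y != vzero -> `|Om y| <= A.
Hypothesis Om_holder : forall x y, x != vzero -> y != vzero ->
  4 * enorm (vsub x y) <= enorm x ->
  `|Om x - Om y| <= A * (enorm (vsub x y) / enorm x) `^ alpha.
Hypothesis gam_gt0 : 0 < gam.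
Hypothesis gam_lt : gam < alpha.
Hypothesis alpha_le1 : alpha <= 1.
Hypothesis beta_gt0 : 0 < beta.
Hypothesis beta_lt : beta < gam.

Definition kap := n%:R - beta.

Hypothesis Om_mean : forall a b, 0 < a -> a <= b ->
  \int[mu]_(y in [set y | a < enorm y <= b]) (enorm y `^ (- kap) * Om y) = 0.

Let n_ge1 : 1 <= n%:R :> R. Proof. by rewrite ler1n. Qed.

Lemma kap_itv : 0 <= kap <= n%:R.
Proof.
rewrite /kap; have := n_ge1; move: (n%:R : R) => N N1.
by apply/andP; split; move: gam_lt alpha_le1 beta_lt beta_gt0 => *; lra.
Qed.

Let kap_ge0 : 0 <= kap. Proof. by case/andP: kap_itv. Qed.

Definition kern y : R := enorm y `^ (- kap) * Om y.

Lemma measurable_enorm_powR k : measurable_fun setT (fun y : V => enorm y `^ k).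
Proof.
rewrite (_ : (fun _ => _) = (@powR R ^~ k) \o @enorm R n)//.
by apply: measurableT_comp => //; exact: measurable_enorm.
Qed.

Lemma measurable_kern : measurable_fun setT kern.
Proof. by apply: measurable_funM => //; exact: measurable_enorm_powR. Qed.

Lemma kern_bound r y : 0 < r -> r <= enorm y -> `|kern y| <= A * r `^ (- kap).
Proof.
move=> r0 ry; rewrite normrM mulrC ler_pM//.
  by apply: Om_bound; rewrite -enorm_gt0 (lt_le_trans r0).
by rewrite ger0_norm ?powR_ge0// powRN_le.
Qed.

Lemma kern_diff y e : 0 < enorm e -> 4 * enorm e <= enorm y ->
  `|kern y - kern (vsub y e)| <=
  A * (1 + n%:R * 2 ^+ n) * enorm e `^ alpha * enorm y `^ (- (kap + alpha)).
Proof.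
move=> e0 ey; have al0 : 0 < alpha by exact: lt_trans gam_lt.
have y0 : 0 < enorm y by lra.
set t := enorm (vsub y e).
have ty : enorm y - enorm e <= t by exact: enorm_vsub_ge.
have yt : t <= enorm y + enorm e by exact: enorm_vsub_le.
have t0 : 0 < t by lra.
have yn : y != vzero by rewrite -enorm_gt0.
have tn : vsub y e != vzero by rewrite -enorm_gt0.
have ee : enorm (vsub y (vsub y e)) = enorm e by rewrite vsubK.
set u := enorm e / enorm y.
have u0 : 0 < u by rewrite divr_gt0.
have u1 : u <= 1 by rewrite ler_pdivrMr// mul1r; lra.
have uE : u `^ alpha * enorm y `^ (- kap) =
    enorm e `^ alpha * enorm y `^ (- (kap + alpha)).
  rewrite /u powRM ?invr_ge0 ?enorm_ge0// -(powR_inv1 (enorm_ge0 y)) -powRrM.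
  rewrite mulN1r -mulrA -powRD_gt0//; congr (_ * _ `^ _); ring.
have uu : u <= u `^ alpha by apply: ger1_powR; rewrite ?u0.
have H1 : `|enorm y `^ (- kap) * (Om y - Om (vsub y e))| <=
    A * (u `^ alpha * enorm y `^ (- kap)).
  rewrite normrM ger0_norm ?powR_ge0// mulrC mulrA ler_wpM2r ?powR_ge0//.
  by have := Om_holder yn tn; rewrite ee; apply.
have H2 : `|enorm y `^ (- kap) - t `^ (- kap)| <=
    n%:R * 2 ^+ n * (u `^ alpha * enorm y `^ (- kap)).
  apply: le_trans (powRN_diff (ltW e0) ey ty yt y0 kap_itv) _.
  have k0 : 0 <= n%:R * 2 ^+ n :> R by rewrite mulr_ge0// exprn_ge0.
  by apply: (ler_wpM2l k0); rewrite ler_wpM2r ?powR_ge0.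
have -> : kern y - kern (vsub y e) = enorm y `^ (- kap) * (Om y - Om (vsub y e)) +
    (enorm y `^ (- kap) - t `^ (- kap)) * Om (vsub y e).
  by rewrite /kern -/t; ring.
apply: le_trans (ler_normD _ _) _.
rewrite [leRHS](_ : _ = A * (u `^ alpha * enorm y `^ (- kap)) +
   (n%:R * 2 ^+ n * (u `^ alpha * enorm y `^ (- kap))) * A); last first.
  by rewrite uE; ring.
by apply: lerD => //; rewrite normrM ler_pM//; exact: Om_bound.
Qed.

Definition eta := gam - beta.

Lemma eta_itv : 0 <= eta <= 1.
Proof.
by rewrite /eta; apply/andP; split;
  move: gam_lt alpha_le1 beta_lt beta_gt0 => *; lra.
Qed.

Lemma exponentE r : 0 < r -> r `^ (- kap) * (r `^ eta * r ^+ n) = r `^ gam.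
Proof.
move=> r0; rewrite -(powR_mulrn _ (ltW r0)) -!powRD_gt0//.
by congr (_ `^ _); rewrite /kap /eta; ring.
Qed.

Definition ratio : R := 2 `^ ((alpha - gam) / 2).

Lemma ratio_gt1 : 1 < ratio.
Proof.
by apply: powR_gt1; rewrite ?ltr1n// divr_gt0// subr_gt0.
Qed.

Let ratio_gt0 : 0 < ratio. Proof. exact: lt_trans ltr01 ratio_gt1. Qed.

Variables (f : V -> R) (L M : R).
Hypothesis mf : measurable_fun setT f.
Hypothesis L_ge0 : 0 <= L.
Hypothesis f_lip : forall x y, `|f x - f y| <= L * enorm (vsub x y) `^ gam.
Hypothesis M_ge0 : 0 <= M.
Hypothesis f_camp : forall x s, 0 < s -> exists a,
  \int[mu]_(y in ccube x s) `|f y - a| <= M * s `^ eta * s ^+ n.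

Definition ball_const : R := 2 ^+ n.+1 * chain_const (n := n) ratio.

Lemma ball_const_ge0 : 0 <= ball_const.
Proof.
by rewrite mulr_ge0 ?exprn_ge0// chain_const_ge0// ratio_gt1.
Qed.

Lemma osc_chain x s : 0 < s -> exists a, forall k,
  \int[mu]_(y in [set y | enorm y <= 2 ^+ k * s]) `|f (vsub x y) - a| <=
  ball_const * ratio ^+ k * M * (2 ^+ k * s) `^ eta * (2 ^+ k * s) ^+ n.
Proof.
move=> s0; rewrite /ball_const.
exact: (chain_ball mu_leb mf L_ge0 (ltW gam_gt0) f_lip M_ge0 eta_itv f_camp
  ratio_gt1 x s0).
Qed.

Lemma measurable_fsub x c : measurable_fun setT (fun y => f (vsub x y) - c).
Proof.
apply: measurable_funB => //.
by apply: measurableT_comp => //; exact: measurable_vsub.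
Qed.

Lemma prod_integrable (E : set V) (H : V -> R) x c (W : R) :
  measurable E -> ebounded E -> measurable_fun setT H ->
  (forall y, E y -> `|H y| <= W) ->
  mu.-integrable E (EFin \o (fun y => H y * (f (vsub x y) - c))).
Proof.
move=> mE bE mH HW; case: (bE) => r Er.
have [C [C0 fC]] := lip_locally_bounded L_ge0 (ltW gam_gt0) f_lip (enorm x + r).
apply: (@bounded_integrable R n mu mu_leb _ _ (W * (C + `|c|))) => //.
  by apply: measurable_funM => //; exact: measurable_fsub.
move=> y Ey; rewrite normrM ler_pM//; first exact: HW.
apply: le_trans (ler_normB _ _) _; rewrite lerD2r fC//.
apply: le_trans (enorm_vsub_le _ _) _; rewrite lerD2l; exact: Er.
Qed.

Lemma oscx_integrable (E : set V) x c : measurable E -> ebounded E ->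
  mu.-integrable E (EFin \o (fun y => `|f (vsub x y) - c|)).
Proof.
move=> mE bE.
have /(_ _)/integrable_abse := @prod_integrable E (cst 1) x c 1 mE bE
  (measurable_cst _).
have i1 : forall y : V, E y -> `|cst 1 y : R| <= 1 by move=> y _ /=; rewrite normr1.
move=> /(_ i1); apply: eq_integrable => // y _ /=; by rewrite mul1r.
Qed.

Lemma weight_bound (E : set V) (H : V -> R) x c b (W : R) :
  measurable E -> E `<=` [set y | enorm y <= b] -> measurable_fun setT H ->
  0 <= W -> (forall y, E y -> `|H y| <= W) ->
  `|\int[mu]_(y in E) (H y * (f (vsub x y) - c))| <=
  W * \int[mu]_(y in [set y | enorm y <= b]) `|f (vsub x y) - c|.
Proof.
move=> mE Eb mH W0 HW.
have bB : ebounded [set y : V | enorm y <= b] by exists b.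
have mB : measurable [set y : V | enorm y <= b] by exact: measurable_ball_le.
have iB := oscx_integrable x c mB bB.
rewrite -RintegralZl//; apply: Rintegral_dominated => //.
- by apply: (prod_integrable x c mE _ mH HW); exists b.
- by have := integrableZl mB W iB; apply: eq_integrable.
- by move=> y _; rewrite mulr_ge0.
- by move=> y Ey; rewrite normrM ler_wpM2r// HW.
Qed.

Lemma kern_shift x c a b : 0 < a -> a <= b ->
  \int[mu]_(y in [set y | a < enorm y <= b]) (kern y * f (vsub x y)) =
  \int[mu]_(y in [set y | a < enorm y <= b]) (kern y * (f (vsub x y) - c)).
Proof.
move=> a0 ab; set E := [set y | _].
have mE : measurable E by exact: measurable_shell.
have bE : ebounded E by exact: bounded_shell.
have KE y : E y -> `|kern y| <= A * a `^ (- kap).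
  by move=> /andP[/ltW ay _]; exact: kern_bound.
have i1 := prod_integrable x 0 mE bE measurable_kern KE.
have i2 := bounded_integrable mu_leb mE bE measurable_kern KE.
rewrite [RHS](_ : _ = \int[mu]_(y in E) (kern y * (f (vsub x y) - 0) - c * kern y)).
  rewrite RintegralB//.
    rewrite RintegralZl// [X in c * X]Om_mean// mulr0 subr0.
    by apply: eq_Rintegral => y _; rewrite subr0.
  by have := integrableZl mE c i2; apply: eq_integrable.
by apply: eq_Rintegral => y _; ring.
Qed.

Definition shell_const : R := A * 2 ^+ n * ball_const.

Lemma shell_const_ge0 : 0 <= shell_const.
Proof.
apply: mulr_ge0; last exact: ball_const_ge0.
by rewrite mulr_ge0 ?exprn_ge0.
Qed.

Lemma one_shell_est x a b : 0 < a -> a <= b -> b <= 2 * a ->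
  `|\int[mu]_(y in [set y | a < enorm y <= b]) (kern y * f (vsub x y))| <=
  shell_const * M * b `^ gam.
Proof.
move=> a0 ab b2; have b0 := lt_le_trans a0 ab.
have [c cP] := osc_chain x b0; rewrite (kern_shift x c a0 ab).
have Aa0 : 0 <= A * a `^ (- kap) by rewrite mulr_ge0// powR_ge0.
apply: (@le_trans _ _ (A * a `^ (- kap) *
    \int[mu]_(y in [set y | enorm y <= b]) `|f (vsub x y) - c|)).
  apply: weight_bound => //; [exact: measurable_shell| |exact: measurable_kern|].
    by move=> y /= /andP[].
  by move=> y /= /andP[/ltW ay _]; exact: kern_bound.
have := cP 0%N; rewrite !expr0 !mul1r mulr1 => H.
apply: (@le_trans _ _ (A * (2 ^+ n * b `^ (- kap)) *
    (ball_const * M * b `^ eta * b ^+ n))).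
  apply: ler_pM => //; first exact: Rintegral_ge0.
  rewrite ler_wpM2l//; apply: powRN_scale => //; [by rewrite ler1n|exact: kap_itv].
by rewrite -(exponentE b0) /shell_const le_eqVlt; apply/orP; left; apply/eqP; ring.
Qed.

Let half_pow : 0 < 1 - 2 `^ (- gam) :> R.
Proof.
rewrite subr_gt0 powRN invf_lt1 ?powR_gt0//.
by rewrite powR_gt1// ltr1n.
Qed.

Definition local_const : R := shell_const / (1 - 2 `^ (- gam)).

Lemma local_const_ge0 : 0 <= local_const.
Proof. by rewrite divr_ge0 ?shell_const_ge0 ?(ltW half_pow). Qed.

Lemma kernf_integrable x a b : 0 < a ->
  mu.-integrable [set y | a < enorm y <= b] (EFin \o (fun y => kern y * f (vsub x y))).
Proof.
move=> a0.
have := @prod_integrable [set y | a < enorm y <= b] kern x 0 (A * a `^ (- kap))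
  (measurable_shell _ _) (bounded_shell _ _) measurable_kern.
have H : forall y : V, [set y | a < enorm y <= b] y -> `|kern y| <= A * a `^ (- kap).
  by move=> y /= /andP[/ltW ay _]; exact: kern_bound.
move=> /(_ H); apply: eq_integrable; first exact: measurable_shell.
by move=> y _ /=; rewrite subr0.
Qed.

Lemma local_est x a b : 0 < a -> a <= b ->
  `|\int[mu]_(y in [set y | a < enorm y <= b]) (kern y * f (vsub x y))| <=
  local_const * M * b `^ gam.
Proof.
move=> a0 ab.
have lcE : local_const = shell_const + local_const * 2 `^ (- gam).
  by rewrite /local_const; field; rewrite gt_eqF.
have sl : shell_const <= local_const.
  rewrite [leRHS]lcE lerDl; apply: mulr_ge0; last exact: powR_ge0.
  exact: local_const_ge0.
have [m bm] : exists m, b <= 2 ^+ m.+1 * a.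
  have : 1 <= b / a by rewrite ler_pdivlMr// mul1r.
  move=> /ex_pow2[k /andP[bk _]]; exists k; rewrite -ler_pdivrMr//.
  by apply: le_trans bk _; rewrite exprS ler_peMl ?ler1n// exprn_ge0.
elim: m b ab bm => [|m IH] b ab bm; have b0 := lt_le_trans a0 ab.
  apply: le_trans (one_shell_est x a0 ab _) _; first by rewrite expr1 in bm.
  by rewrite ler_wpM2r ?powR_ge0// ler_wpM2r.
have [b2|/ltW b2] := leP b (2 * a).
  apply: le_trans (one_shell_est x a0 ab b2) _.
  by rewrite ler_wpM2r ?powR_ge0// ler_wpM2r.
have ab2 : a <= b / 2 by lra.
have b2b : b / 2 <= b by lra.
rewrite (Rintegral_shell_split ab2 b2b (kernf_integrable x b a0)).
apply: le_trans (ler_normD _ _) _.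
have H1 : `|\int[mu]_(y in [set y | a < enorm y <= b / 2]) (kern y * f (vsub x y))|
    <= local_const * M * (b / 2) `^ gam.
  by apply: IH => //; rewrite ler_pdivrMr// -mulrA mulrC -mulrA -exprS mulrC.
have H2 := one_shell_est x (lt_le_trans a0 ab2) b2b.
have /H2 {}H2 : b <= 2 * (b / 2) by lra.
apply: le_trans (lerD H1 H2) _.
have -> : (b / 2) `^ gam = b `^ gam * 2 `^ (- gam).
  by rewrite powRM ?(ltW b0)// -(powR_inv1 (ler0n R 2)) -powRrM mulN1r.
rewrite [in leRHS]lcE le_eqVlt; apply/orP; left; apply/eqP; ring.
Qed.

Definition far_const : R := ball_const * 2 ^+ n.+1 * ratio.

Lemma far_const_ge0 : 0 <= far_const.
Proof.
apply: mulr_ge0; last exact: ltW.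
by apply: mulr_ge0; [exact: ball_const_ge0|rewrite exprn_ge0].
Qed.

Let far_weight y : R := enorm y `^ (- (kap + alpha)).

Let alpha_gt0 : 0 < alpha. Proof. exact: lt_trans gam_lt. Qed.

Let far_weight_le r y : 0 < r -> r <= enorm y -> far_weight y <= r `^ (- (kap + alpha)).
Proof. by move=> r0 ry; apply: powRN_le => //; rewrite addr_ge0// ltW. Qed.

Let far_integrable x c a b : 0 < a -> mu.-integrable [set y | a < enorm y <= b]
  (EFin \o (fun y => far_weight y * `|f (vsub x y) - c|)).
Proof.
move=> a0.
have := @prod_integrable [set y | a < enorm y <= b] far_weight x c
  (a `^ (- (kap + alpha))) (measurable_shell _ _) (bounded_shell _ _)
  (measurable_enorm_powR _).
have H : forall y : V, [set y | a < enorm y <= b] y ->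
    `|far_weight y| <= a `^ (- (kap + alpha)).
  move=> y /= /andP[/ltW ay _]; rewrite ger0_norm ?powR_ge0//.
  exact: far_weight_le.
move=> /(_ H)/integrable_abse; apply: eq_integrable; first exact: measurable_shell.
by move=> y _ /=; rewrite normrM [X in (X * _)%:E]ger0_norm ?powR_ge0.
Qed.

Lemma far_est x s c : 0 < s ->
  (forall k, \int[mu]_(y in [set y | enorm y <= 2 ^+ k * s]) `|f (vsub x y) - c| <=
    ball_const * ratio ^+ k * M * (2 ^+ k * s) `^ eta * (2 ^+ k * s) ^+ n) ->
  forall m, \int[mu]_(y in [set y | s < enorm y <= 2 ^+ m * s])
      (enorm y `^ (- (kap + alpha)) * `|f (vsub x y) - c|) <=
    far_const / (1 - ratio^-1) * M * s `^ (gam - alpha).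
Proof.
move=> s0 cP m.
have rt1 : 0 < 1 - ratio^-1 by rewrite subr_gt0 invf_lt1// ratio_gt1.
suff H : \int[mu]_(y in [set y | s < enorm y <= 2 ^+ m * s])
      (enorm y `^ (- (kap + alpha)) * `|f (vsub x y) - c|) <=
    far_const * M * s `^ (gam - alpha) * ((1 - ratio^-1 ^+ m) / (1 - ratio^-1)).
  apply: le_trans H _.
  rewrite [leRHS](_ : _ = far_const * M * s `^ (gam - alpha) * (1 / (1 - ratio^-1)));
    last by ring.
  apply: ler_wpM2l.
    apply: mulr_ge0; last exact: powR_ge0.
    by apply: mulr_ge0 => //; exact: far_const_ge0.
  rewrite ler_pM2r ?invr_gt0// gerBl exprn_ge0// invr_ge0 ltW//.
elim: m => [|m IH].
  rewrite !expr0 subrr mul0r mulr0 mul1r.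
  have -> : [set y : V | s < enorm y <= s] = set0.
    apply/seteqP; split => y //= /andP[h1 h2].
    by have := lt_le_trans h1 h2; rewrite ltxx.
  by rewrite Rintegral_set0.
set r := 2 ^+ m * s; have r0 : 0 < r by rewrite mulr_gt0// exprn_gt0.
have sr : s <= r by rewrite /r ler_peMl ?(ltW s0)// exprn_ege1// ler1n.
have E2 : 2 ^+ m.+1 * s = 2 * r by rewrite exprS mulrA.
have r2 : r <= 2 * r by lra.
rewrite E2 (Rintegral_shell_split sr r2 (far_integrable x c _ s0)).
have geo : (1 - ratio^-1 ^+ m.+1) / (1 - ratio^-1) =
    (1 - ratio^-1 ^+ m) / (1 - ratio^-1) + ratio^-1 ^+ m.
  rewrite exprS; move: (ratio^-1 ^+ m) => q; move: rt1.
  by move: (ratio^-1) => p p1; field; rewrite gt_eqF.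
rewrite geo mulrDr; apply: lerD => //.
apply: le_trans (ler_norm _) _.
apply: (@le_trans _ _ (r `^ (- (kap + alpha)) *
   \int[mu]_(y in [set y | enorm y <= 2 * r]) `|f (vsub x y) - c|)).
  have mB : measurable [set y : V | enorm y <= 2 * r] by exact: measurable_ball_le.
  have iB : mu.-integrable [set y : V | enorm y <= 2 * r]
      (EFin \o (fun y => `|f (vsub x y) - c|)).
    by apply: oscx_integrable => //; exists (2 * r).
  rewrite -RintegralZl//; apply: Rintegral_dominated => //.
  - exact: measurable_shell.
  - by move=> y /= /andP[].
  - exact: far_integrable.
  - by have := integrableZl mB (r `^ (- (kap + alpha))) iB; apply: eq_integrable.
  - by move=> y _; rewrite mulr_ge0// powR_ge0.
  - move=> y /= /andP[/ltW ry _]; rewrite normrM normr_id ger0_norm ?powR_ge0//.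
    by rewrite ler_wpM2r// far_weight_le.
have := cP m.+1; rewrite E2 => H.
apply: (@le_trans _ _ (r `^ (- (kap + alpha)) *
    (ball_const * ratio ^+ m.+1 * M * (2 * r `^ eta) * (2 ^+ n * r ^+ n)))).
  rewrite ler_wpM2l ?powR_ge0//; apply: le_trans H _.
  rewrite (exprMn _ 2 r) ler_wpM2r ?mulr_ge0 ?exprn_ge0 ?(ltW r0)//.
  apply: ler_wpM2l.
    apply: mulr_ge0 => //; apply: mulr_ge0; first exact: ball_const_ge0.
    by rewrite exprn_ge0// ltW.
  apply: (@powR_scale _ 2 r eta 1) => //; [by rewrite ler1n|exact: ltW|].
  by case/andP: eta_itv.
have rE : r `^ (- (kap + alpha)) * (r `^ eta * r ^+ n) =
    ratio^-1 ^+ m * ratio^-1 ^+ m * s `^ (gam - alpha).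
  rewrite -(powR_mulrn _ (ltW r0)) -!powRD_gt0//.
  have -> : - (kap + alpha) + (eta + n%:R) = gam - alpha by rewrite /kap /eta; ring.
  rewrite powRM ?exprn_ge0 ?(ltW s0)//; congr (_ * _).
  rewrite -exprMn -(powR_inv1 (ltW ratio_gt0)) /ratio -powRrM -powRD_gt0//.
  rewrite -(powR_mulrn _ (ler0n R 2)) -powRrM -powR_mulrn ?powR_ge0// -powRrM.
  by congr (_ `^ _); field.
rewrite [leLHS](_ : _ = ball_const * 2 ^+ n.+1 * M * ratio ^+ m.+1 *
   (r `^ (- (kap + alpha)) * (r `^ eta * r ^+ n))); last by rewrite (exprS 2 n); ring.
rewrite rE /far_const (exprS ratio) le_eqVlt; apply/orP; left; apply/eqP.
have rr : ratio ^+ m * ratio^-1 ^+ m = 1.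
  by rewrite -exprMn divff ?expr1n// gt_eqF.
rewrite [LHS](_ : _ = ball_const * 2 ^+ n.+1 * M * ratio *
   (ratio ^+ m * ratio^-1 ^+ m) * ratio^-1 ^+ m * s `^ (gam - alpha)); last by ring.
by rewrite rr; ring.
Qed.

Definition diff_const : R := 2 * A * (ball_const * ratio * 8 ^+ n.+1) +
  A * (1 + n%:R * 2 ^+ n) * (far_const / (1 - ratio^-1)).

Lemma diff_const_ge0 : 0 <= diff_const.
Proof.
have rt1 : 0 < 1 - ratio^-1 by rewrite subr_gt0 invf_lt1// ratio_gt1.
apply: addr_ge0; apply: mulr_ge0.
- exact: mulr_ge0.
- apply: mulr_ge0; last by rewrite exprn_ge0.
  by apply: mulr_ge0; [exact: ball_const_ge0|exact: ltW].
- by apply: mulr_ge0 => //; rewrite addr_ge0// mulr_ge0// exprn_ge0.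
- by apply: divr_ge0; [exact: far_const_ge0|exact: ltW].
Qed.

Definition decay : R := (alpha + gam) / 2 - 1.

Lemma growth_est x c : exists E, 0 <= E /\ forall r y, 1 <= r -> enorm y <= 2 * r ->
  `|f (vsub x y) - c| <= E * r `^ ((alpha - gam) / 2 + eta).
Proof.
have [E [E0 EP]] := camp_growth mu_leb mf L_ge0 (ltW gam_gt0) f_lip M_ge0 eta_itv
  f_camp ratio_gt1 x c.
exists (E * 8 ^+ 2); split; first by rewrite mulr_ge0// exprn_ge0.
move=> r y r1 yr; have r0 : 0 < r by lra.
have [k /andP[k1 k2]] : exists k, 4 * r <= 2 ^+ k <= 2 * (4 * r).
  by apply: ex_pow2; lra.
have /EP H : enorm y < 2 ^+ k by lra.
apply: le_trans H _; rewrite -[leLHS]mulrA -[leRHS]mulrA; apply: ler_wpM2l => //.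
have k0 : 0 < 2 ^+ k :> R by rewrite exprn_gt0.
have -> : ratio ^+ k * (2 ^+ k) `^ eta = (2 ^+ k) `^ ((alpha - gam) / 2 + eta).
  rewrite (powRD_gt0 ((alpha - gam) / 2) eta k0); congr (_ * _).
  rewrite -(powR_mulrn _ (ltW ratio_gt0)) /ratio -powRrM.
  by rewrite -(powR_mulrn k (ler0n R 2)) -powRrM [X in _ `^ X]mulrC.
have [et0 et1] := andP eta_itv.
have q0 : 0 <= (alpha - gam) / 2 + eta.
  by rewrite addr_ge0// divr_ge0// subr_ge0 ltW.
have q2 : (alpha - gam) / 2 + eta <= 2%:R.
  by move: et1 alpha_le1 gam_gt0 => *; lra.
have c8 : 1 <= 8 :> R by rewrite ler1n.
apply: le_trans (powR_scale c8 (ltW r0) q2).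
apply: powR_le => //; lra.
Qed.

Lemma far_diff_est x z s c (h := enorm (vsub x z)) : 0 < h -> s = 4 * h ->
  (forall k, \int[mu]_(y in [set y | enorm y <= 2 ^+ k * s]) `|f (vsub x y) - c| <=
    ball_const * ratio ^+ k * M * (2 ^+ k * s) `^ eta * (2 ^+ k * s) ^+ n) ->
  exists E, 0 <= E /\ forall r, 1 <= r -> 8 * h <= r ->
  `|\int[mu]_(y in [set y | s < enorm y <= r]) (kern y * (f (vsub x y) - c)) -
    \int[mu]_(y in [set y | s < enorm y <= r]) (kern y * (f (vsub z y) - c))| <=
  diff_const * M * h `^ gam + E * r `^ decay.
Proof.
move=> h0 sE cP; set e := vsub x z.
have eh : enorm e = h by [].
have [E [E0 EP]] := growth_est x c.
pose vol := unit_ball_volume mu.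
have vol0 : 0 <= vol by exact: unit_ball_volume_ge0.
exists (2 * A * 2 ^+ n * E * (n%:R * (2 * h) * 2 ^+ n * vol)); split.
  apply: mulr_ge0; first by rewrite !mulr_ge0// exprn_ge0.
  by rewrite !mulr_ge0 ?exprn_ge0 ?(ltW h0).
move=> r r1 hr; have r0 : 0 < r by lra.
set An := [set y : V | s < enorm y <= r].
have mAn : measurable An by exact: measurable_shell.
have s0 : 0 < s by lra.
set U := [set y : V | s - h < enorm y <= r + h].
have mU : measurable U by exact: measurable_shell.
have bU : ebounded U by exact: bounded_shell.
have lo y : enorm y - h <= enorm (vsub y e) by rewrite -eh; exact: enorm_vsub_ge.
have hi y : enorm (vsub y e) <= enorm y + h by rewrite -eh; exact: enorm_vsub_le.
pose J y : R := \1_An y * kern y - \1_An (vsub y e) * kern (vsub y e).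
have mK := measurable_kern.
have mJ : measurable_fun setT J.
  apply: measurable_funB; apply: measurable_funM => //.
  - by apply: (measurableT_comp (measurable_indic _)) => //; exact: measurable_vsubr.
  - by apply: measurableT_comp => //; exact: measurable_vsubr.
have KA t y : 0 < t -> t <= enorm y -> `|\1_An y * kern y| <= A * t `^ (- kap).
  move=> t0 ty; rewrite normrM; apply: le_trans (kern_bound t0 ty).
  rewrite ler_piMl// indicE; case: (_ \in _) => /=; by rewrite ?normr1 ?normr0.
have JW t y : 0 < t -> t + h <= enorm y -> `|J y| <= 2 * A * t `^ (- kap).
  move=> t0 ty; apply: le_trans (ler_normB _ _) _.
  rewrite -mulrA mulrDl mul1r lerD// KA//; first lra.
  by have := lo y; lra.
have AnU : An `<=` U by move=> y /= /andP[? ?]; apply/andP; split; lra.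
have AnU' : (vsub^~ e) @^-1` An `<=` U.
  move=> y /= /andP[? ?]; have := lo y; have := hi y => ? ?.
  by apply/andP; split; lra.
have mAn' : measurable ((vsub^~ e) @^-1` An).
  by rewrite -[X in measurable X]setTI; exact: measurable_vsubr.
have bAn' : ebounded ((vsub^~ e) @^-1` An).
  by exists (r + h) => y /AnU' /= /andP[].
have fz y : f (vsub z (vsub y e)) = f (vsub x y).
  by congr f; apply: eq_from_tnth => i; rewrite !tnth_vsub; ring.
have iU t (H : V -> R) (W : R) : measurable_fun setT H -> (forall y, U y -> `|H y| <= W) ->
    mu.-integrable U (EFin \o (fun y => H y * (f (vsub t y) - c))).
  exact: prod_integrable.
have sh0 : 0 < s - 2 * h by lra.
have KU y : U y -> `|\1_An y * kern y| <= A * (s - 2 * h) `^ (- kap).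
  by move=> /= /andP[? ?]; apply: KA => //; lra.
have KU' y : U y -> `|\1_An (vsub y e) * kern (vsub y e)| <= A * (s - 2 * h) `^ (- kap).
  by move=> /= /andP[? ?]; apply: KA => //; have := lo y; lra.
have mK1 : measurable_fun setT (fun y => \1_An y * kern y).
  by apply: measurable_funM.
have mK2 : measurable_fun setT (fun y => \1_An (vsub y e) * kern (vsub y e)).
  apply: measurable_funM.
  - by apply: (measurableT_comp (measurable_indic _)) => //; exact: measurable_vsubr.
  - by apply: measurableT_comp => //; exact: measurable_vsubr.
have -> : \int[mu]_(y in An) (kern y * (f (vsub x y) - c)) =
    \int[mu]_(y in U) ((\1_An y * kern y) * (f (vsub x y) - c)).
  rewrite (Rintegral_indic _ _ AnU).
  by apply: eq_Rintegral => y _; rewrite mulrA.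
have -> : \int[mu]_(y in An) (kern y * (f (vsub z y) - c)) =
    \int[mu]_(y in U) ((\1_An (vsub y e) * kern (vsub y e)) * (f (vsub x y) - c)).
  have mG : measurable_fun setT (fun y => kern y * (f (vsub z y) - c)).
    by apply: measurable_funM => //; exact: measurable_fsub.
  rewrite -(@Rintegral_translate R n mu mu_leb e An _ mAn mG).
    rewrite (Rintegral_indic _ _ AnU'); apply: eq_Rintegral => y _.
    by rewrite fz mulrA; congr (_ * _ * _); rewrite !indicE.
  have i1 := @prod_integrable ((vsub^~ e) @^-1` An) (fun y => kern (vsub y e)) x c
    (A * s `^ (- kap)) mAn' bAn'.
  have mKe : measurable_fun setT (fun y => kern (vsub y e)).
    by apply: measurableT_comp => //; exact: measurable_vsubr.
  have Kb (y : V) : ((vsub^~ e) @^-1` An) y -> `|kern (vsub y e)| <= A * s `^ (- kap).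
    by move=> /= /andP[/ltW ? _]; exact: kern_bound.
  have := i1 mKe Kb; apply: eq_integrable => // y _ /=; by rewrite fz.
rewrite -RintegralB//; [|exact: iU KU|exact: iU KU'].
rewrite (_ : \int[mu]_(y in U) _ = \int[mu]_(y in U) (J y * (f (vsub x y) - c))); last first.
  by apply: eq_Rintegral => y _; rewrite /J; ring.
have iJ : mu.-integrable U (EFin \o (fun y => J y * (f (vsub x y) - c))).
  apply: (iU x J (2 * A * (s - 2 * h) `^ (- kap)) mJ) => y /= /andP[? ?].
  by apply: JW => //; lra.
have l1 : s - h <= s + h by lra.
have l2 : s + h <= r - h by lra.
have l3 : r - h <= r + h by lra.
have l23 := le_trans l2 l3.
rewrite (Rintegral_shell_split l1 l23 iJ).
have iJ2 : mu.-integrable [set y : V | s + h < enorm y <= r + h]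
    (EFin \o (fun y => J y * (f (vsub x y) - c))).
  apply: (integrableS _ _ _ iJ) => //; first exact: measurable_shell.
  by move=> y /= /andP[? ?]; apply/andP; split; lra.
rewrite (Rintegral_shell_split l2 l3 iJ2) addrA.
have H1 : `|\int[mu]_(y in [set y | s - h < enorm y <= s + h])
      (J y * (f (vsub x y) - c))| <=
    2 * A * (ball_const * ratio * 8 ^+ n.+1) * M * h `^ gam.
  apply: (@le_trans _ _ (2 * A * h `^ (- kap) *
      \int[mu]_(y in [set y | enorm y <= 2 ^+ 1 * s]) `|f (vsub x y) - c|)).
    apply: weight_bound => //; first exact: measurable_shell.
    - by move=> y /= /andP[_ ?]; rewrite expr1; lra.
    - by rewrite !mulr_ge0// powR_ge0.
    - by move=> y /= /andP[? _]; apply: JW => //; lra.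
  have c0 : 0 <= 2 * A * h `^ (- kap) by rewrite !mulr_ge0// powR_ge0.
  apply: le_trans (ler_wpM2l c0 (cP 1%N)) _.
  have -> : 2 ^+ 1 * s = 8 * h by rewrite sE expr1; ring.
  rewrite expr1 (exprMn _ 8 h).
  have P8 : (8 * h) `^ eta <= 8 * h `^ eta.
    apply: (@powR_scale _ 8 h eta 1) => //; [by rewrite ler1n|exact: ltW|].
    by case/andP: eta_itv.
  apply: (@le_trans _ _ (2 * A * h `^ (- kap) * (ball_const * ratio * M *
      (8 * h `^ eta) * (8 ^+ n * h ^+ n)))).
    apply: ler_wpM2l => //; apply: ler_wpM2r.
      by rewrite mulr_ge0// exprn_ge0// ltW.
    apply: ler_wpM2l => //; apply: mulr_ge0 => //.
    by apply: mulr_ge0; [exact: ball_const_ge0|exact: ltW].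
  rewrite -(exponentE h0) (exprS 8 n) le_eqVlt; apply/orP; left; apply/eqP; ring.
have H2 : `|\int[mu]_(y in [set y | s + h < enorm y <= r - h])
      (J y * (f (vsub x y) - c))| <=
    A * (1 + n%:R * 2 ^+ n) * (far_const / (1 - ratio^-1)) * M * h `^ gam.
  have [m /andP[rm _]] : exists m, r / s <= 2 ^+ m <= 2 * (r / s).
    by apply: ex_pow2; rewrite ler_pdivlMr//; lra.
  have rms : r <= 2 ^+ m * s by rewrite -ler_pdivrMr.
  have k0 : 0 <= A * (1 + n%:R * 2 ^+ n) * h `^ alpha.
    by rewrite !mulr_ge0 ?powR_ge0// addr_ge0// mulr_ge0// exprn_ge0.
  have mS : measurable [set y : V | s < enorm y <= 2 ^+ m * s].
    exact: measurable_shell.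
  apply: (@le_trans _ _ (A * (1 + n%:R * 2 ^+ n) * h `^ alpha *
      \int[mu]_(y in [set y | s < enorm y <= 2 ^+ m * s])
      (enorm y `^ (- (kap + alpha)) * `|f (vsub x y) - c|))).
    have ifar := far_integrable x c (2 ^+ m * s) s0.
    rewrite -RintegralZl//; apply: Rintegral_dominated => //.
    - exact: measurable_shell.
    - by move=> y /= /andP[? ?]; apply/andP; split; lra.
    - apply: (integrableS _ _ _ iJ2) => //; try exact: measurable_shell.
      by move=> y /= /andP[? ?]; apply/andP; split; lra.
    - by have := integrableZl mS (A * (1 + n%:R * 2 ^+ n) * h `^ alpha) ifar;
        apply: eq_integrable.
    - by move=> y _; rewrite !mulr_ge0 ?powR_ge0// addr_ge0// mulr_ge0// exprn_ge0.
    - move=> y /= /andP[y1 y2]; have lo' := lo y; have hi' := hi y.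
      have -> : J y = kern y - kern (vsub y e).
        rewrite /J !indicE !mem_set ?mul1r//.
        + by apply/andP; split; lra.
        + by apply/andP; split; lra.
      have y4 : 4 * h <= enorm y.
        by rewrite -sE; apply: le_trans (ltW y1); rewrite lerDl ltW.
      rewrite normrM mulrA; apply: (ler_wpM2r (normr_ge0 _)).
      exact: (@kern_diff y e h0 y4).
  have := far_est s0 cP m => H.
  apply: le_trans (ler_wpM2l k0 H) _.
  have hs : s `^ (gam - alpha) <= h `^ (gam - alpha).
    rewrite -opprB; apply: powRN_le => //; last by lra.
    by rewrite subr_ge0 ltW.
  have rt1 : 0 < 1 - ratio^-1 by rewrite subr_gt0 invf_lt1// ratio_gt1.
  have q0 : 0 <= far_const / (1 - ratio^-1) * M.
    by apply: mulr_ge0 => //; apply: divr_ge0; [exact: far_const_ge0|exact: ltW].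
  apply: le_trans (ler_wpM2l k0 (ler_wpM2l q0 hs)) _.
  have -> : h `^ gam = h `^ alpha * h `^ (gam - alpha).
    by rewrite -powRD_gt0//; congr (_ `^ _); ring.
  rewrite le_eqVlt; apply/orP; left; apply/eqP; ring.
have H3 : `|\int[mu]_(y in [set y | r - h < enorm y <= r + h])
      (J y * (f (vsub x y) - c))| <=
    2 * A * 2 ^+ n * E * (n%:R * (2 * h) * 2 ^+ n * vol) * r `^ decay.
  have rh0 : 0 < r - h by lra.
  have W1 (y : V) : [set y | r - h < enorm y <= r + h] y ->
      `|J y * (f (vsub x y) - c)| <= 2 * A * (2 ^+ n * r `^ (- kap)) *
        (E * r `^ ((alpha - gam) / 2 + eta)).
    move=> /= /andP[y1 y2]; rewrite normrM ler_pM//.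
      have rh : 0 < r - 2 * h by lra.
      apply: le_trans (JW (r - 2 * h) y rh _) _; first lra.
      rewrite ler_wpM2l ?mulr_ge0//; apply: powRN_scale => //.
      - by rewrite ler1n.
      - lra.
      - exact: kap_itv.
    by apply: EP => //; lra.
  apply: le_trans (Rintegral_le_bound mu_leb _ _ _ W1) _.
  - exact: measurable_shell.
  - exact: bounded_shell.
  - by apply: measurable_funM => //; exact: measurable_fsub.
  rewrite (lebesgue_shell mu_leb rh0 l3).
  have B1 : (r + h) ^+ n - (r - h) ^+ n <= n%:R * (2 * h) * 2 ^+ n * (r ^+ n * r `^ (- 1)).
    have rh : 0 < r + h by lra.
    apply: le_trans (exprB_le n (ltW rh0) rh) _.
    have -> : (r + h - (r - h)) / (r + h) = 2 * h / (r + h) by congr (_ / _); ring.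
    have B2 : (r + h) ^+ n <= 2 ^+ n * r ^+ n.
      have rh2 : r + h <= 2 * r by lra.
      by rewrite -exprMn lerXn2r ?nnegrE ?mulr_ge0 ?(ltW rh) ?(ltW r0).
    have B3 : 2 * h / (r + h) <= 2 * h * r^-1.
      rewrite ler_wpM2l ?mulr_ge0 ?(ltW h0)// lef_pV2 ?posrE//; lra.
    rewrite (powR_inv1 (ltW r0)).
    apply: (@le_trans _ _ (n%:R * (2 * h * r^-1) * (2 ^+ n * r ^+ n))).
      apply: ler_pM => //.
      - by rewrite mulr_ge0// divr_ge0// ?mulr_ge0 ?(ltW h0)// ltW.
      - by rewrite exprn_ge0// ltW.
      - exact: ler_wpM2l.
    by rewrite le_eqVlt; apply/orP; left; apply/eqP; ring.
  have W0 : 0 <= 2 * A * (2 ^+ n * r `^ (- kap)) * (E * r `^ ((alpha - gam) / 2 + eta)).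
    by rewrite !mulr_ge0 ?powR_ge0 ?exprn_ge0.
  apply: le_trans (ler_wpM2l W0 (ler_wpM2r vol0 B1)) _.
  have -> : r `^ decay = r `^ (- kap) * r `^ ((alpha - gam) / 2 + eta) *
      (r ^+ n * r `^ (- 1)).
    rewrite -(powR_mulrn _ (ltW r0)) -!powRD_gt0//; congr (_ `^ _).
    by rewrite /decay /kap /eta; field.
  rewrite le_eqVlt; apply/orP; left; apply/eqP; ring.
apply: le_trans (ler_normD _ _) _; apply: lerD => //.
apply: le_trans (ler_normD _ _) _; apply: le_trans (lerD H1 H2) _.
by rewrite /diff_const le_eqVlt; apply/orP; left; apply/eqP; ring.
Qed.

Definition main_const : R := 8 * local_const + diff_const.

Lemma main_const_ge0 : 0 <= main_const.
Proof.
apply: addr_ge0; last exact: diff_const_ge0.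
by apply: mulr_ge0 => //; exact: local_const_ge0.
Qed.

Definition trunc (eps : R) x : R :=
  \int[mu]_(y in [set y | eps < enorm y < eps^-1]) (kern y * f (vsub x y)).

Lemma trunc_diff x z (del : R) : x != z -> 0 < del ->
  \forall eps \near (0 : R)^'+,
    `|trunc eps x - trunc eps z| <=
    main_const * M * enorm (vsub x z) `^ gam + del.
Proof.
rewrite -enorm_vsub_gt0; set h := enorm (vsub x z) => h0 del0.
have s0 : 0 < 4 * h by rewrite mulr_gt0.
have [c cP] := osc_chain x s0.
have [E [E0 EP]] := far_diff_est h0 (erefl (4 * h)) cP.
have dec : 0 < - decay.
  by rewrite /decay; move: gam_lt alpha_le1 => *; lra.
have cv : (fun eps : R => E * eps `^ (- decay)) @ 0^'+ --> (0 : R).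
  suff : (fun eps : R => E * eps `^ (- decay)) @ 0^'+ --> E * 0 by rewrite mulr0.
  by apply: cvgM; [exact: cvg_cst|exact: powR_cvg0].
near=> eps.
have e0 : 0 < eps by near: eps; exact: nbhs_right_gt.
have e1 : eps < 1 by near: eps; exact: nbhs_right_lt.
have e4 : eps < 4 * h by near: eps; exact: nbhs_right_lt.
have e8 : eps < (8 * h)^-1.
  by near: eps; apply: nbhs_right_lt; rewrite invr_gt0 mulr_gt0.
have eE : E * eps `^ (- decay) <= del.
  by near: eps; apply: (cvgr_le _ cv).
have i0 : 0 < eps^-1 by rewrite invr_gt0.
have i1 : 1 <= eps^-1 by rewrite invf_ge1// ltW.
have i8 : 8 * h <= eps^-1.
  by rewrite -[leLHS]invrK lef_pV2 ?posrE ?invr_gt0 ?mulr_gt0// ltW.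
have ei : eps < eps^-1 by rewrite (lt_le_trans e1).
have si : 4 * h <= eps^-1 by lra.
have split w : trunc eps w =
    \int[mu]_(y in [set y | eps < enorm y <= 4 * h]) (kern y * f (vsub w y)) +
    \int[mu]_(y in [set y | 4 * h < enorm y <= eps^-1]) (kern y * (f (vsub w y) - c)).
  rewrite /trunc (Rintegral_oshell mu_leb ei i0 (kernf_integrable w _ e0)).
  rewrite (Rintegral_shell_split (ltW e4) si (kernf_integrable w _ e0)).
  by rewrite (kern_shift w c s0 si).
rewrite !split.
have L1 := local_est x e0 (ltW e4); have L2 := local_est z e0 (ltW e4).
have H := EP _ i1 i8.
have P4 : (4 * h) `^ gam <= 4 * h `^ gam.
  apply: (@powR_scale _ 4 h gam 1) => //; [by rewrite ler1n|exact: ltW|].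
  by rewrite (le_trans (ltW gam_lt)).
have lM : 0 <= local_const * M by apply: mulr_ge0 => //; exact: local_const_ge0.
have P5 := ler_wpM2l lM P4.
have dE : (eps^-1) `^ decay = eps `^ (- decay).
  by rewrite -(powR_inv1 (ltW e0)) -powRrM mulN1r.
rewrite dE in H.
move: L1 L2 H.
set I1 := \int[mu]_(y in _) _; set I2 := \int[mu]_(y in _) _ => L1.
set I3 := \int[mu]_(y in _) _; set I4 := \int[mu]_(y in _) _ => L2 H.
have -> : I1 + I3 - (I2 + I4) = (I1 - I2) + (I3 - I4) by ring.
apply: le_trans (ler_normD _ _) _.
apply: le_trans (lerD (le_trans (ler_normB I1 I2)
  (lerD (le_trans L1 P5) (le_trans L2 P5))) (le_trans H (lerD (lexx _) eE))) _.
by rewrite /main_const -/h le_eqVlt; apply/orP; left; apply/eqP; ring.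
Unshelve. all: by end_near. Qed.

End SingularIntegral.

(** * Interpolation and complex components *)

Section Interpolation.
Context {R : realType}.
Implicit Types (u v t : R).

Let powR_split u t : 0 < u -> u `^ (1 - t) * u `^ t = u.
Proof. by move=> u0; rewrite -powRD_gt0// subrK powRr1// ltW. Qed.

Lemma le_interp w u v t : 0 <= w -> w <= u -> w <= v -> 0 < t < 1 ->
  w <= u `^ (1 - t) * v `^ t.
Proof.
rewrite le_eqVlt => /predU1P[<- *|w0 wu wv /andP[t0 t1]].
  by rewrite mulr_ge0 ?powR_ge0.
rewrite -[leLHS](powR_split t w0); apply: ler_pM; rewrite ?powR_ge0//.
  by apply: powR_le; rewrite ?subr_ge0 ?(ltW t1) ?(ltW w0).
by apply: powR_le; rewrite ?(ltW t0) ?(ltW w0).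
Qed.

Lemma interp_le u v t : 0 <= u -> 0 <= v -> 0 < t < 1 ->
  u `^ (1 - t) * v `^ t <= u + v.
Proof.
move=> u0 v0 /andP[t0 t1].
have : 0 <= u + v by exact: addr_ge0.
rewrite le_eqVlt => /predU1P[E|s0].
  have -> : v = 0 by lra.
  by rewrite (powR0 (lt0r_neq0 t0)) mulr0 addr0.
rewrite -[leRHS](powR_split t s0); apply: ler_pM; rewrite ?powR_ge0//.
  by apply: powR_le; rewrite ?subr_ge0 ?(ltW t1) ?lerDl.
by apply: powR_le; rewrite ?(ltW t0) ?lerDr.
Qed.

Lemma powR_selfN_le u : 0 < u -> u `^ (- u) <= expR 1.
Proof.
move=> u0; rewrite -mulN1r powRrM (powR_inv1 (ltW u0)).
have ui : u^-1 <= expR u^-1 by have := expR_ge1Dx u^-1; lra.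
apply: (le_trans (powR_le (ltW u0) _ ui)); first by rewrite invr_ge0 ltW.
by rewrite /powR gt_eqF ?expR_gt0// expRK divff// gt_eqF.
Qed.

End Interpolation.

Section Complex.
Context {R : realType} {n : nat}.
Local Notation V := (n.-tuple R).
Local Notation Re := complex.Re.
Local Notation Im := complex.Im.

Lemma cabs_ge0 (z : Cx R) : 0 <= cabs z.
Proof. exact: sqrtr_ge0. Qed.

Lemma normRe_le_cabs (z w : Cx R) : `|Re z - Re w| <= cabs (csub z w).
Proof.
rewrite -sqrtr_sqr ler_sqrt ?lerDl ?addr_ge0 ?sqr_ge0//.
Qed.

Lemma normIm_le_cabs (z w : Cx R) : `|Im z - Im w| <= cabs (csub z w).
Proof.
rewrite -sqrtr_sqr ler_sqrt ?lerDr ?addr_ge0 ?sqr_ge0//.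
Qed.

Lemma cabs_le (z w : Cx R) : cabs (csub z w) <= `|Re z - Re w| + `|Im z - Im w|.
Proof.
rewrite -(@ler_pXn2r _ 2) ?nnegrE ?addr_ge0 ?cabs_ge0//.
rewrite sqr_sqrtr ?addr_ge0 ?sqr_ge0//= [leRHS]sqrrD !real_normK ?num_real//.
by rewrite [leRHS]addrAC lerDl mulrn_wge0// mulr_ge0.
Qed.

Lemma measurable_fun_vne0 (g : V -> R) :
  measurable_fun [set x | x != vzero] g -> measurable_fun setT g.
Proof.
move=> mg.
have m0 : measurable [set vzero : V].
  rewrite (_ : [set vzero] = ~` [set x : V | x != vzero]).
    by apply: measurableC; exact: measurable_vne0.
  by apply/seteqP; split => x /= => [->|/negP/negPn/eqP//]; rewrite eqxx.
have -> : [set: V] = [set x | x != vzero] `|` [set vzero].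
  by apply/seteqP; split => // x _; case: (eqVneq x vzero); [right|left].
apply/measurable_funU => //; first exact: measurable_vne0.
split => //; apply: (eq_measurable_fun (cst (g vzero))) => //.
by move=> x; rewrite inE /= => ->.
Qed.

End Complex.

Section Assembly.
Context {R : realType} {n : nat}.
Local Notation V := (n.-tuple R).
Local Notation Re := complex.Re.
Local Notation Im := complex.Im.
Implicit Types (x y z : V) (G g : V -> R) (f Om : V -> Cx R).
Variable mu : {measure set V -> \bar R}.
Hypothesis n_gt0 : (0 < n)%N.
Hypothesis mu_leb : is_lebesgue mu.

Definition rough_kernel (A alpha : R) G := [/\ measurable_fun setT G,
  (forall y, y != vzero -> `|G y| <= A),
  (forall x y, x != vzero -> y != vzero -> 4 * enorm (vsub x y) <= enorm x ->
     `|G x - G y| <= A * (enorm (vsub x y) / enorm x) `^ alpha) &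
  (forall k a b, 0 <= k -> 0 < a -> a <= b ->
     \int[mu]_(y in [set y | a < enorm y <= b]) (enorm y `^ (- k) * G y) = 0)].

Lemma rough_kernelP (sig : {measure set V -> \bar R}) G (C alpha : R) :
  is_surface_measure mu sig -> 0 < alpha <= 1 -> 0 <= C ->
  measurable_fun setT G ->
  (forall r y, 0 < r -> y != vzero -> G (vscale r y) = G y) ->
  (forall x y, enorm x = 1 -> enorm y = 1 -> enorm (vsub x y) <= 2^-1 ->
    `|G x - G y| <= C * enorm (vsub x y) `^ alpha) ->
  \int[sig]_(x in sphere) G x = 0 ->
  exists A0, 0 <= A0 /\ forall A, A0 <= A -> rough_kernel A alpha G.
Proof.
move=> surf al C0 mG homG holG meanG; have [al0 _] := andP al.
have [A1 [A10 GA]] := sphere_bounded n_gt0 (ltW al0) C0 holG.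
exists (A1 + 2 * C); split; first by rewrite addr_ge0// mulr_ge0.
move=> A AA.
have bG y : y != vzero -> `|G y| <= A.
  move=> y0; rewrite -(homG (enorm y)^-1 y) ?invr_gt0 ?enorm_gt0//.
  by apply: le_trans (GA _ (enorm_udir y0)) _; lra.
split => //.
- move=> x y x0 y0 xy.
  apply: le_trans (hom_holder al C0 homG holG x0 y0 xy) _.
  by rewrite ler_wpM2r ?powR_ge0//; lra.
- move=> k a b k0 a0 ab.
  exact: (weighted_mean_zero n_gt0 mu_leb surf mG bG homG meanG k0 a0 ab).
Qed.

Definition lip_campanato (L M gam e : R) g := [/\ measurable_fun setT g,
  (forall x y, `|g x - g y| <= L * enorm (vsub x y) `^ gam) &
  (forall x s, 0 < s -> exists a,
     \int[mu]_(y in ccube x s) `|g y - a| <= M * s `^ e * s ^+ n)].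

(* At each scale the smaller of the Lipschitz and the mean oscillation bounds is
   dominated by their geometric interpolation, which has the homogeneity of
   the Campanato space of order [gam - beta]. *)
Lemma lip_bmo_campanato (L B gam beta : R) g : 0 <= L -> 0 <= B ->
  0 < beta < gam -> gam <= 1 -> measurable_fun setT g ->
  (forall x y, `|g x - g y| <= L * enorm (vsub x y) `^ gam) ->
  (forall x s, 0 < s -> exists a,
     \int[mu]_(y in ccube x s) `|g y - a| <= B * (2 * s) ^+ n) ->
  lip_campanato L (n%:R * 2 ^+ n * (L `^ (1 - beta / gam) * B `^ (beta / gam)))
    gam (gam - beta) g.
Proof.
move=> L0 B0 /andP[b0 bg] g1 mg lipg bmog; split => // x s s0.
have g0 : 0 < gam := lt_trans b0 bg.
have n1 : 1 <= n%:R :> R by rewrite ler1n.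
have t01 : 0 < beta / gam < 1 by rewrite divr_gt0//= ltr_pdivrMr// mul1r.
have q0 : 0 <= (2 * s) ^+ n by rewrite exprn_ge0// mulr_ge0// ltW.
have [a aP] : exists a, \int[mu]_(y in ccube x s) `|g y - a| <=
    n%:R * Num.min (L * s `^ gam) B * (2 * s) ^+ n.
  have [LB|/ltW BL] := leP (L * s `^ gam) B.
    exists (g x); rewrite -(lebesgue_ccube mu_leb x (ltW s0)).
    apply: le_trans (ler_norm _) _; apply: (Rintegral_le_bound mu_leb).
    - exact: measurable_ccube.
    - exact: bounded_ccube.
    - by apply: measurableT_comp => //; exact: measurable_funB.
    - move=> y /ccube_enorm yx; rewrite normr_id; apply: le_trans (lipg _ _) _.
      rewrite mulrCA ler_wpM2l//.
      apply: le_trans (powR_le (ltW g0) (enorm_ge0 _) yx) _.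
      exact: (@powR_scale _ n%:R s gam 1 n1 (ltW s0) g1).
  have [a aP] := bmog x s s0; exists a; apply: le_trans aP _.
  by rewrite ler_wpM2r// ler_peMl.
exists a; apply: le_trans aP _.
have w0 : 0 <= Num.min (L * s `^ gam) B.
  by rewrite le_min B0 mulr_ge0// powR_ge0.
have wu : Num.min (L * s `^ gam) B <= L * s `^ gam by rewrite ge_min lexx.
have wv : Num.min (L * s `^ gam) B <= B by rewrite ge_min lexx orbT.
have := le_interp w0 wu wv t01; rewrite (powRM _ L0 (powR_ge0 _ _)) -powRrM.
have -> : gam * (1 - beta / gam) = gam - beta by field; rewrite gt_eqF.
move=> H; rewrite exprMn.
have n0 : 0 <= n%:R * (2 ^+ n * s ^+ n) :> R.
  by rewrite !mulr_ge0 ?exprn_ge0// ltW.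
have {}H := ler_wpM2l n0 H.
rewrite [leLHS](_ : _ = n%:R * (2 ^+ n * s ^+ n) * Num.min (L * s `^ gam) B);
  last by ring.
by apply: le_trans H _; rewrite le_eqVlt; apply/orP; left; apply/eqP; ring.
Qed.

Lemma lim_diff_le (u v : R -> R) (lu lv K : R) :
  u @ 0^'+ --> lu -> v @ 0^'+ --> lv ->
  (forall del, 0 < del -> \forall eps \near (0 : R)^'+, `|u eps - v eps| <= K + del) ->
  `|lu - lv| <= K.
Proof.
move=> ulu vlv H; apply/ler_addgt0Pr => del del0.
have cv : (fun eps => `|u eps - v eps|) @ 0^'+ --> `|lu - lv|.
  by apply: cvg_norm; exact: cvgB.
exact: (cvgr_to_le cv (H _ del0)).
Qed.

Section Bound.
Variables (A alpha gam beta L M : R).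
Hypothesis A_ge0 : 0 <= A.
Hypothesis gam_gt0 : 0 < gam.
Hypothesis gam_lt : gam < alpha.
Hypothesis alpha_le1 : alpha <= 1.
Hypothesis beta_gt0 : 0 < beta.
Hypothesis beta_lt : beta < gam.
Hypothesis L_ge0 : 0 <= L.
Hypothesis M_ge0 : 0 <= M.

Let kap0 : 0 <= kap (n := n) beta.
Proof. by case/andP: (kap_itv n_gt0 gam_lt alpha_le1 beta_gt0 beta_lt). Qed.

Lemma rough_trunc_diff G g x z del : rough_kernel A alpha G ->
  lip_campanato L M gam (gam - beta) g -> x != z -> 0 < del ->
  \forall eps \near (0 : R)^'+,
    `|trunc mu G beta g eps x - trunc mu G beta g eps z| <=
    main_const (n := n) A alpha gam * M * enorm (vsub x z) `^ gam + del.
Proof.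
move=> [mG bG hG meanG] [mg lipg campg] xz del0.
exact: (trunc_diff n_gt0 mu_leb mG A_ge0 bG hG gam_gt0 gam_lt alpha_le1 beta_gt0
  beta_lt (fun a b => meanG _ a b kap0) mg L_ge0 lipg M_ge0 campg xz del0).
Qed.

Lemma trunc_integrable G g x eps : rough_kernel A alpha G ->
  lip_campanato L M gam (gam - beta) g -> 0 < eps ->
  mu.-integrable [set y | eps < enorm y < eps^-1]
    (EFin \o (fun y => kern G beta y * g (vsub x y))).
Proof.
move=> [mG bG _ _] [mg lipg _] e0.
have := kernf_integrable n_gt0 mu_leb mG bG gam_gt0 gam_lt alpha_le1 beta_gt0
  beta_lt mg L_ge0 lipg x eps^-1 e0.
apply: integrableS; [exact: measurable_shell|exact: measurable_oshell|].
by move=> y /= /andP[-> /ltW].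
Qed.

Variables (Om f : V -> Cx R).
Hypothesis Om_Re : rough_kernel A alpha (fun y => Re (Om y)).
Hypothesis Om_Im : rough_kernel A alpha (fun y => Im (Om y)).
Hypothesis f_Re : lip_campanato L M gam (gam - beta) (fun y => Re (f y)).
Hypothesis f_Im : lip_campanato L M gam (gam - beta) (fun y => Im (f y)).

Lemma Re_TtruncE eps x : 0 < eps -> Re (Ttrunc mu Om beta f eps x) =
  trunc mu (fun y => Re (Om y)) beta (fun y => Re (f y)) eps x -
  trunc mu (fun y => Im (Om y)) beta (fun y => Im (f y)) eps x.
Proof.
move=> e0; rewrite /trunc -RintegralB.
- apply: eq_Rintegral => y _; rewrite /kern /kap powRN /=; ring.
- exact: measurable_oshell.
- exact: (trunc_integrable x Om_Re f_Re e0).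
- exact: (trunc_integrable x Om_Im f_Im e0).
Qed.

Lemma Im_TtruncE eps x : 0 < eps -> Im (Ttrunc mu Om beta f eps x) =
  trunc mu (fun y => Re (Om y)) beta (fun y => Im (f y)) eps x +
  trunc mu (fun y => Im (Om y)) beta (fun y => Re (f y)) eps x.
Proof.
move=> e0; rewrite /trunc -RintegralD.
- apply: eq_Rintegral => y _; rewrite /kern /kap powRN /=; ring.
- exact: measurable_oshell.
- exact: (trunc_integrable x Om_Re f_Im e0).
- exact: (trunc_integrable x Om_Im f_Re e0).
Qed.

Lemma Tbeta_diff (Tf : V -> Cx R) x z : is_Tbeta mu Om beta f Tf -> x != z ->
  cabs (csub (Tf x) (Tf z)) <=
  4 * main_const (n := n) A alpha gam * M * enorm (vsub x z) `^ gam.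
Proof.
move=> Tf_lim xz; pose K := main_const (n := n) A alpha gam * M * enorm (vsub x z) `^ gam.
have [Rx Ix] := Tf_lim x; have [Rz Iz] := Tf_lim z.
have HR : `|Re (Tf x) - Re (Tf z)| <= 2 * K.
  apply: (lim_diff_le Rx Rz) => del del0.
  have d2 : 0 < del / 2 by rewrite divr_gt0.
  near=> eps; have e0 : 0 < eps by near: eps; exact: nbhs_right_gt.
  rewrite !Re_TtruncE//.
  have : `|trunc mu (fun y => Re (Om y)) beta (fun y => Re (f y)) eps x -
           trunc mu (fun y => Re (Om y)) beta (fun y => Re (f y)) eps z| <= K + del / 2.
    by near: eps; exact: rough_trunc_diff.
  have : `|trunc mu (fun y => Im (Om y)) beta (fun y => Im (f y)) eps x -
           trunc mu (fun y => Im (Om y)) beta (fun y => Im (f y)) eps z| <= K + del / 2.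
    by near: eps; exact: rough_trunc_diff.
  move: (trunc _ _ _ _ _ _) (trunc _ _ _ _ _ _) (trunc _ _ _ _ _ _)
    (trunc _ _ _ _ _ _) (K) => a b c d k.
  rewrite !ler_norml => /andP[? ?] /andP[? ?]; apply/andP; split; lra.
have HI : `|Im (Tf x) - Im (Tf z)| <= 2 * K.
  apply: (lim_diff_le Ix Iz) => del del0.
  have d2 : 0 < del / 2 by rewrite divr_gt0.
  near=> eps; have e0 : 0 < eps by near: eps; exact: nbhs_right_gt.
  rewrite !Im_TtruncE//.
  have : `|trunc mu (fun y => Re (Om y)) beta (fun y => Im (f y)) eps x -
           trunc mu (fun y => Re (Om y)) beta (fun y => Im (f y)) eps z| <= K + del / 2.
    by near: eps; exact: rough_trunc_diff.
  have : `|trunc mu (fun y => Im (Om y)) beta (fun y => Re (f y)) eps x -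
           trunc mu (fun y => Im (Om y)) beta (fun y => Re (f y)) eps z| <= K + del / 2.
    by near: eps; exact: rough_trunc_diff.
  move: (trunc _ _ _ _ _ _) (trunc _ _ _ _ _ _) (trunc _ _ _ _ _ _)
    (trunc _ _ _ _ _ _) (K) => a b c d k.
  rewrite !ler_norml => /andP[? ?] /andP[? ?]; apply/andP; split; lra.
apply: le_trans (cabs_le _ _) _; apply: le_trans (lerD HR HI) _.
by rewrite le_eqVlt; apply/orP; left; apply/eqP; rewrite /K; ring.
Unshelve. all: by end_near. Qed.

End Bound.

Lemma lip_norm_ge0 gam f : (0 <= lip_norm gam f)%E.
Proof.
pose o : V := [tuple 1 | i < n].
have o0 : o != vzero.
  apply/eqP => /(congr1 (fun t => tnth t (Ordinal n_gt0))).
  by rewrite !tnth_mktuple => /eqP; rewrite oner_eq0.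
apply: (@le_trans _ _ (cabs (csub (f o) (f vzero)) / enorm (vsub o vzero) `^ gam)%:E).
  by rewrite lee_fin divr_ge0 ?cabs_ge0 ?powR_ge0.
by apply: ereal_sup_ubound; exists o, vzero.
Qed.

Lemma lip_normP gam f x y : lip_norm gam f \is a fin_num ->
  cabs (csub (f x) (f y)) <= fine (lip_norm gam f) * enorm (vsub x y) `^ gam.
Proof.
move=> fin; have [->|xy] := eqVneq x y.
  rewrite (_ : cabs _ = 0) ?mulr_ge0 ?powR_ge0// ?fine_ge0 ?lip_norm_ge0//.
  by rewrite /cabs /= !subrr expr0n /= addr0 sqrtr0.
rewrite -ler_pdivrMr ?powR_gt0 ?enorm_vsub_gt0//.
by rewrite -lee_fin fineK//; apply: ereal_sup_ubound; exists x, y.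
Qed.

Lemma measurable_cabs f c : cmeasurable setT f ->
  measurable_fun setT (fun y => cabs (csub (f y) c)).
Proof.
move=> [mR mI].
apply: (measurableT_comp (@measurable_sqrtr R)).
by apply: measurable_funD; apply: measurable_funX; exact: measurable_funB.
Qed.

Lemma bmo_norm_ge0 f : (0 <= bmo_norm mu f)%E.
Proof.
pose Q : set V := cube vzero 1.
apply: (@le_trans _ _ (((fine (mu Q))^-1)%:E *
   \int[mu]_(x in Q) (cabs (csub (f x) (cavg mu Q f)))%:E)%E).
  rewrite mule_ge0 ?lee_fin ?invr_ge0 ?fine_ge0//.
  by apply: integral_ge0 => x _; rewrite lee_fin cabs_ge0.
by apply: ereal_sup_ubound; exists Q; split => //; exists vzero, 1.
Qed.

Lemma bmo_normP f x s : bmo_norm mu f \is a fin_num -> 0 < s ->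
  (\int[mu]_(y in ccube x s) (cabs (csub (f y) (cavg mu (ccube x s) f)))%:E <=
   (fine (bmo_norm mu f) * (2 * s) ^+ n)%:E)%E.
Proof.
move=> fin s0; have s2 : 0 < 2 * s by rewrite mulr_gt0.
have p0 : 0 < (2 * s) ^+ n by rewrite exprn_gt0.
have := @ereal_sup_ubound R [set v | exists Q, is_cube Q /\
   v = (((fine (mu Q))^-1)%:E *
       \int[mu]_(x in Q) (cabs (csub (f x) (cavg mu Q f)))%:E)%E] _
  (ex_intro _ (ccube x s) (conj (ex_intro _ _ (ex_intro _ _ (conj s2 erefl))) erefl)).
rewrite -/(bmo_norm mu f) (lebesgue_ccube mu_leb x (ltW s0)) => H.
by rewrite mulrC EFinM -lee_pdivrMl// fineK.
Qed.

Lemma bmo_comp f (comp : Cx R -> R) x s :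
  (forall z w : Cx R, `|comp z - comp w| <= cabs (csub z w)) ->
  measurable_fun setT (fun y => comp (f y)) -> cmeasurable setT f ->
  bmo_norm mu f \is a fin_num -> 0 < s -> exists a,
  \int[mu]_(y in ccube x s) `|comp (f y) - a| <= fine (bmo_norm mu f) * (2 * s) ^+ n.
Proof.
move=> cle mc mf fin s0; have H := bmo_normP x fin s0.
exists (comp (cavg mu (ccube x s) f)).
have H' : (\int[mu]_(y in ccube x s)
    (`|comp (f y) - comp (cavg mu (ccube x s) f)|)%:E <=
    (fine (bmo_norm mu f) * (2 * s) ^+ n)%:E)%E.
  apply: le_trans H; apply: ge0_le_integral => //.
  - exact: measurable_ccube.
  - apply/measurable_EFinP; apply: measurable_funTS.
    by apply: measurableT_comp => //; exact: measurable_funB.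
  - apply/measurable_EFinP; apply: measurable_funTS; exact: measurable_cabs.
  - by move=> y _; rewrite lee_fin.
rewrite -lee_fin /Rintegral fineK//.
rewrite ge0_fin_numE; first exact: le_lt_trans H' (ltry _).
exact: integral_ge0.
Qed.

End Assembly.

Theorem theorem1p3 (R : realType) (n : nat)
    (mu sig : {measure set (n.-tuple R) -> \bar R})
    (Om : n.-tuple R -> Cx R) (alpha p q : R) :
  (0 < n)%N ->
  is_lebesgue mu ->
  is_surface_measure mu sig ->
  (* Omega restricted to S^{n-1} is in L^infty(S^{n-1}) *)
  cmeasurable [set x | x != vzero] Om ->
  (ess_sup sig (fun x => (cabs (Om x))%:E) < +oo)%E ->
  (* homogeneous of degree 0 *)
  (forall (r : R) (x : n.-tuple R), 0 < r -> x != vzero -> Om (vscale r x) = Om x) ->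
  (* mean zero on the sphere *)
  cintegral sig sphere Om = complex.Complex 0 0 ->
  (* Dini-type condition *)
  0 < alpha <= 1 ->
  (\int[lebesgue_measure]_(d in `]0%R, 1%R] : set R) (omega_inf Om d * ((d `^ (1 + alpha))^-1)%:E)
     < +oo)%E ->
  n%:R / (n%:R + alpha) < p < 1 -> 1 < q ->
  p^-1 + q^-1 = 2 ->
  exists C : R, 0 < C /\
    forall (beta : R) (f Tf : n.-tuple R -> Cx R),
      0 < beta < (q - 1) * n%:R / q ->
      cmeasurable setT f -> loc_integrable mu f ->
      (lip_norm (n%:R * (p^-1 - 1)) f < +oo)%E ->
      (bmo_norm mu f < +oo)%E ->
      is_Tbeta mu Om beta f Tf ->
      (lip_norm (n%:R * (p^-1 - 1)) Tf <=
        C%:E * (lip_norm (n%:R * (p^-1 - 1)) f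
          + (beta `^ ((q - 1) * n%:R / q) / (n%:R * (q - 1) - beta * q) `^ q^-1)%:E
            * bmo_norm mu f))%E.
Proof.
move=> n0 leb surf [mOR mOI] _ homO meanO al dini pn q1 pq.
have [al0 al1] := andP al; have [pl p1] := andP pn.
have nR : 0 < n%:R :> R by rewrite ltr0n.
have p0 : 0 < p by apply: lt_trans pl; rewrite divr_gt0// addr_gt0.
have q0 : 0 < q by exact: lt_trans q1.
set gam := n%:R * (p^-1 - 1).
have gamE : gam = (q - 1) * n%:R / q.
  rewrite /gam (_ : p^-1 = 2 - q^-1); last by rewrite -pq addrK.
  by field; rewrite gt_eqF.
have gam0 : 0 < gam by rewrite mulr_gt0// subr_gt0 invf_gt1.
have gam_al : gam < alpha.
  have pi : p^-1 < (n%:R + alpha) / n%:R.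
    by rewrite -[ltRHS]invrK ltf_pV2 ?posrE ?invr_gt0 ?divr_gt0 ?addr_gt0// invf_div.
  rewrite /gam mulrBr mulr1 ltrBlDl -ltr_pdivlMl//.
  by rewrite mulrC.
have [C [C0 holO]] := dini_holder al0 dini.
have [AR [AR0 kerR]] := rough_kernelP n0 leb surf al C0 (measurable_fun_vne0 mOR)
  (fun r y r0 y0 => congr1 (@complex.Re R) (homO r y r0 y0))
  (fun x y x1 y1 xy => le_trans (normRe_le_cabs _ _) (holO x y x1 y1 xy))
  (congr1 (@complex.Re R) meanO).
have [AI [AI0 kerI]] := rough_kernelP n0 leb surf al C0 (measurable_fun_vne0 mOI)
  (fun r y r0 y0 => congr1 (@complex.Im R) (homO r y r0 y0))
  (fun x y x1 y1 xy => le_trans (normIm_le_cabs _ _) (holO x y x1 y1 xy))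
  (congr1 (@complex.Im R) meanO).
pose A := AR + AI.
have A0 : 0 <= A by exact: addr_ge0.
have {}kerR : rough_kernel mu A alpha (fun y => complex.Re (Om y)).
  by apply: kerR; rewrite lerDl.
have {}kerI : rough_kernel mu A alpha (fun y => complex.Im (Om y)).
  by apply: kerI; rewrite lerDr.
have [Cm [Cm0 CmE]] : exists Cm, 0 <= Cm /\ Cm = main_const (n := n) A alpha gam.
  by eexists; split; last reflexivity; exact: main_const_ge0.
pose D0 := (q * gam) `^ q^-1.
have D00 : 0 <= D0 by exact: powR_ge0.
pose K := 4 * Cm * (n%:R * 2 ^+ n) * expR 1 * (1 + D0).
have K0 : 0 <= K.
  have e0 : 0 <= expR 1 :> R by exact: expR_ge0.
  have d0 : 0 <= 1 + D0 by exact: addr_ge0.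
  have n2 : 0 <= n%:R * 2 ^+ n :> R by rewrite mulr_ge0 ?exprn_ge0// ltW.
  by rewrite /K; apply: mulr_ge0 => //; apply: mulr_ge0 => //; rewrite !mulr_ge0.
exists (K + 1); split; first by rewrite ltr_wpDl.
move=> beta f Tf; rewrite -gamE => /andP[b0 bg] mf _ lipf bmof Tf_lim.
have Lfin : lip_norm gam f \is a fin_num.
  by rewrite ge0_fin_numE// lip_norm_ge0.
have Bfin : bmo_norm mu f \is a fin_num.
  by rewrite ge0_fin_numE// bmo_norm_ge0.
have L0 : 0 <= fine (lip_norm gam f) by rewrite fine_ge0// lip_norm_ge0.
have B0 : 0 <= fine (bmo_norm mu f) by rewrite fine_ge0// bmo_norm_ge0.
have lipP x y := lip_normP n0 x y Lfin.
have bg' : 0 < beta < gam by rewrite b0.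
have gam1 : gam <= 1 by rewrite (le_trans (ltW gam_al)).
have [mfR mfI] := mf.
have campR := lip_bmo_campanato n0 leb L0 B0 bg' gam1 mfR
  (fun x y => le_trans (normRe_le_cabs _ _) (lipP x y))
  (fun x s => @bmo_comp R n mu leb f (@complex.Re R) x s normRe_le_cabs mfR mf Bfin).
have campI := lip_bmo_campanato n0 leb L0 B0 bg' gam1 mfI
  (fun x y => le_trans (normIm_le_cabs _ _) (lipP x y))
  (fun x s => @bmo_comp R n mu leb f (@complex.Im R) x s normIm_le_cabs mfI mf Bfin).
rewrite -(fineK Lfin) -(fineK Bfin).
move: (fine (lip_norm gam f)) (fine (bmo_norm mu f)) L0 B0 campR campI {lipP} =>
  L B L0 B0 campR campI.
set M0 := L `^ (1 - beta / gam) * B `^ (beta / gam) in campR campI.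
have M00 : 0 <= M0 by rewrite mulr_ge0 ?powR_ge0.
have n2 : 0 <= n%:R * 2 ^+ n :> R by rewrite mulr_ge0 ?exprn_ge0// ltW.
set cb := beta `^ gam / _.
have gb0 : 0 < n%:R * (q - 1) - beta * q.
  rewrite subr_gt0 -ltr_pdivlMr//; suff -> : n%:R * (q - 1) / q = gam by [].
  by rewrite gamE; congr (_ / _); rewrite mulrC.
have cb0 : 0 <= cb by rewrite divr_ge0 ?powR_ge0.
have M0K : M0 <= expR 1 * (1 + D0) * (L + cb * B).
  have t01 : 0 < beta / gam < 1 by rewrite divr_gt0//= ltr_pdivrMr// mul1r.
  have bB0 : 0 <= beta `^ gam * B by rewrite mulr_ge0 ?powR_ge0.
  have -> : M0 = beta `^ (- beta) *
      (L `^ (1 - beta / gam) * (beta `^ gam * B) `^ (beta / gam)).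
    rewrite (powRM _ (powR_ge0 _ _) B0) -powRrM.
    have -> : gam * (beta / gam) = beta by field; rewrite gt_eqF.
    rewrite /M0 powRN; field; by rewrite gt_eqF// powR_gt0.
  have bD : beta `^ gam * B <= D0 * (cb * B).
    rewrite mulrA ler_wpM2r// /cb mulrCA ler_peMr ?powR_ge0//.
    rewrite ler_pdivlMr ?powR_gt0// mul1r; apply: powR_le.
    - by rewrite invr_ge0 ltW.
    - exact: ltW.
    - have -> : q * gam = n%:R * (q - 1) by rewrite gamE; field; rewrite gt_eqF.
      by rewrite gerBl mulr_ge0// ltW.
  rewrite -mulrA; apply: ler_pM; rewrite ?powR_ge0// ?mulr_ge0 ?powR_ge0//.
    exact: powR_selfN_le.
  apply: le_trans (interp_le L0 bB0 t01) _.
  have cB0 : 0 <= cb * B by exact: mulr_ge0.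
  have := mulr_ge0 D00 L0.
  by rewrite mulrDl mul1r mulrDr; lra.
rewrite -EFinM; apply: ge_ereal_sup => _ [x [z [xz ->]]].
rewrite lee_fin ler_pdivrMr ?powR_gt0 ?enorm_vsub_gt0//.
have := Tbeta_diff n0 leb A0 gam0 gam_al al1 b0 bg L0 (mulr_ge0 n2 M00)
  kerR kerI campR campI Tf_lim xz.
rewrite -CmE => /le_trans; apply; rewrite ler_wpM2r ?powR_ge0//.
have LB0 : 0 <= L + cb * B by rewrite addr_ge0// mulr_ge0.
have k0 : 0 <= 4 * Cm * (n%:R * 2 ^+ n).
  by apply: mulr_ge0 => //; exact: mulr_ge0.
apply: (@le_trans _ _ (K * (L + cb * B))); last by rewrite ler_wpM2r// lerDl.
rewrite [leLHS]mulrA; apply: le_trans (ler_wpM2l k0 M0K) _.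
by rewrite /K !mulrA.
Qed.
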